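(* Let $n\ge1$. The topological group $\mathrm{Ham}^c(S^1\times\mathbb{R}^{2n}\times S^1)$, endowed with the $\mathcal{C}^0$-topology, does not have the Rokhlin property.
   Context: A topological group $G$ has the Rokhlin property if there is $g\in G$ whose conjugacy class $\{hgh^{-1}\mid h\in G\}$ is dense in $G$. $S^1=\mathbb{R}/\mathbb{Z}$; $d_\eta\sigma=d\sigma-\eta\wedge\sigma$. On $S^1\times\mathbb{R}^{2n}\times S^1$, with coordinates $\theta$ on the first $S^1$, $(x_1,y_1,\dots,x_n,y_n)$ on $\mathbb{R}^{2n}$ and $z$ on the last $S^1$, put $\eta=-d\theta$, $\alpha_0=\sum_{j=1}^n\frac{x_jdy_j-y_jdx_j}{2}-dz$ and $\omega=d_{-d\theta}\alpha_0=d\alpha_0+d\theta\wedge\alpha_0$. $\mathrm{Ham}^c(S^1\times\mathbb{R}^{2n}\times S^1)$ is the group of time-$1$ maps of flows (starting at the identity) of compactly supported time-dependent vector fields $X_t$ with $\iota_{X_t}\omega=-d_\eta H_t$ for smooth functions $H_t$. The $\mathcal{C}^0$-topology is taken with respect to the distance on $S^1\times\mathbb{R}^{2n}\times S^1$ induced by the Euclidean distance on $\mathbb{R}^{2n+2}$. *)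

(* Defs.v *)
From HB Require Import structures.
From mathcomp Require Import all_boot all_order all_algebra.
From mathcomp Require Import generic_quotient ring lra.
From mathcomp Require Import all_classical all_reals all_analysis.

Set Implicit Arguments.
Unset Strict Implicit.
Unset Printing Implicit Defensive.

Import Order.TTheory GRing.Theory Num.Theory.
Import numFieldNormedType.Exports.

Local Open Scope classical_set_scope.
Local Open Scope ring_scope.
Local Open Scope quotient_scope.

HB.mixin Record isTopologicalGroup T & Group T & Topological T := {
  mulg_continuous : continuous (fun x : T * T => (x.1 * x.2)%g);
  invg_continuous : continuous (fun x : T => (x^-1)%g)
}.

#[short(type="topologicalGroupType")]
HB.structure Definition TopologicalGroup :=
  {T of Group T & Topological T & isTopologicalGroup T}.

(* To be used for a subgroup G of T, with the subspace topology: a subset of G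
   is dense in G iff its closure in T contains G. *)
Definition rokhlin_property (T : topologicalGroupType) (G : set T) :=
  exists2 g : T, G g & G `<=` closure [set (h * g * h^-1)%g | h in G].

(* The group of uniform homeomorphisms of a uniform space, with the topology of
   uniform convergence. *)
Section UniformHomeomorphisms.
Variable M : uniformType.

Record uhomeo := UHomeo {
  uhfun : M -> M;
  uhinv : M -> M;
  uhfunK : cancel uhfun uhinv;
  uhinvK : cancel uhinv uhfun;
  uhfun_continuous : unif_continuous uhfun;
  uhinv_continuous : unif_continuous uhinv }.

Lemma uhomeo_eq (f g : uhomeo) : uhfun f =1 uhfun g -> f = g.
Proof.
case: f g => [f f' fK f'K cf cf'] [g g' gK g'K cg cg'] /= /funext efg.
subst g; have e : f' = g'.
  by apply/funext => x; rewrite -{1}[x]g'K fK.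
subst g'; congr UHomeo; exact: Prop_irrelevance.
Qed.

Lemma unif_continuous_id : unif_continuous (@id M).
Proof. by move=> A; rewrite /= /nbhs /=; apply: filterS => -[]. Qed.

Lemma unif_continuous_comp (f g : M -> M) :
  unif_continuous f -> unif_continuous g -> unif_continuous (f \o g).
Proof. by move=> cf cg A /cf /cg. Qed.

Definition uhomeo_one := UHomeo (fun=> erefl) (fun=> erefl)
  unif_continuous_id unif_continuous_id.

Definition uhomeo_mul (f g : uhomeo) := UHomeo
  (can_comp (uhfunK f) (uhfunK g)) (can_comp (uhinvK g) (uhinvK f))
  (unif_continuous_comp (@uhfun_continuous f) (@uhfun_continuous g))
  (unif_continuous_comp (@uhinv_continuous g) (@uhinv_continuous f)).

Definition uhomeo_inv (f : uhomeo) := UHomeo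
  (uhinvK f) (uhfunK f) (@uhinv_continuous f) (@uhfun_continuous f).

HB.instance Definition _ := gen_eqMixin uhomeo.
HB.instance Definition _ := gen_choiceMixin uhomeo.

Lemma uhomeo_mulA : associative uhomeo_mul.
Proof. by move=> f g h; apply: uhomeo_eq. Qed.
Lemma uhomeo_mul1 : left_id uhomeo_one uhomeo_mul.
Proof. by move=> f; apply: uhomeo_eq. Qed.
Lemma uhomeo_1mul : right_id uhomeo_one uhomeo_mul.
Proof. by move=> f; apply: uhomeo_eq. Qed.
Lemma uhomeo_mulV : left_inverse uhomeo_one uhomeo_inv uhomeo_mul.
Proof. by move=> f; apply: uhomeo_eq => x /=; rewrite uhfunK. Qed.
Lemma uhomeo_Vmul : right_inverse uhomeo_one uhomeo_inv uhomeo_mul.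
Proof. by move=> f; apply: uhomeo_eq => x /=; rewrite uhinvK. Qed.

HB.instance Definition _ := isGroup.Build uhomeo
  uhomeo_mulA uhomeo_mul1 uhomeo_1mul uhomeo_mulV uhomeo_Vmul.

HB.instance Definition _ := Topological.copy uhomeo
  (initial_topology (uhfun : uhomeo -> {uniform M -> M})).

Lemma uhomeo_nbhs (f : uhomeo) (P : set uhomeo) :
  nbhs f P <-> exists2 E, entourage E &
    [set g : uhomeo | forall x, E (uhfun f x, uhfun g x)] `<=` P.
Proof.
split.
  rewrite nbhsE => -[Q [[A oA AQ] Qf] QP].
  have : nbhs (uhfun f : {uniform M -> M}) A.
    by apply: open_nbhs_nbhs; split => //; have := Qf; rewrite -AQ.
  move=> /uniform_nbhs[E [entE EA]]; exists E => // g Eg.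
  by apply: QP; rewrite -AQ; apply: EA => y _ /=; exact: Eg.
move=> [E entE EP]; apply: filterS EP _.
apply: (@initial_continuous _ _ (uhfun : uhomeo -> {uniform M -> M}) f
  [set h : {uniform M -> M} | forall x, E (uhfun f x, h x)]).
by apply/uniform_nbhs; exists E; split => // h Eh y; exact: Eh.
Qed.

Lemma uhomeo_mulg_continuous :
  continuous (fun x : uhomeo * uhomeo => (x.1 * x.2)%g).
Proof.
move=> [f g] P /uhomeo_nbhs[E entE EP].
have entE' := entourage_split_ent entE.
have [D entD DE] : exists2 D, entourage D & forall x y, D (x, y) ->
    split_ent E (uhfun f x, uhfun f y).
  by exists [set xy | split_ent E (uhfun f xy.1, uhfun f xy.2)] => //;
    exact: (@uhfun_continuous f _ entE').
exists ([set f' : uhomeo | forall x, split_ent E (uhfun f x, uhfun f' x)],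
        [set g' : uhomeo | forall x, D (uhfun g x, uhfun g' x)]) => /=.
  by split; apply/uhomeo_nbhs; [exists (split_ent E) | exists D].
move=> [f' g'] /= [ff' gg']; apply: EP => x /=.
by apply: (entourage_split (uhfun f (uhfun g' x))) => //; exact: DE.
Qed.

Lemma uhomeo_invg_continuous : continuous (fun x : uhomeo => (x^-1)%g).
Proof.
move=> f P /uhomeo_nbhs[E entE EP].
have entE' := entourage_inv entE.
have entD : entourage [set xy | E (uhinv f xy.2, uhinv f xy.1)].
  exact: (@uhinv_continuous f _ entE').
apply/uhomeo_nbhs; exists [set xy | E (uhinv f xy.2, uhinv f xy.1)] => //.
move=> g fg; apply: EP => x /=.
by have /= := fg (uhinv g x); rewrite uhfunK uhinvK.
Qed.

HB.instance Definition _ := isTopologicalGroup.Build uhomeo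
  uhomeo_mulg_continuous uhomeo_invg_continuous.

End UniformHomeomorphisms.

Section Smooth.
Variables (R : realType) (U V : normedModType R).

Fixpoint class_C (k : nat) (f : U -> V) : Prop :=
  if k is k'.+1 then
    (forall x, differentiable f x) /\ forall v, class_C k' (fun x => 'D_v f x)
  else continuous f.

Definition smooth (f : U -> V) := forall k, class_C k f.

End Smooth.

Section Circle.
Variable R : realType.

Definition eq_mod1 (x y : R) := (x - y) \is a Num.int.

Lemma eq_mod1_refl : reflexive eq_mod1.
Proof. by move=> x; rewrite /eq_mod1 subrr rpred0. Qed.
Lemma eq_mod1_sym : symmetric eq_mod1.
Proof. by move=> x y; rewrite /eq_mod1 -opprB rpredN. Qed.
Lemma eq_mod1_trans : transitive eq_mod1.
Proof. by move=> y x z xy yz; rewrite /eq_mod1 -(subrKA y) rpredD. Qed.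

Canonical eq_mod1_equiv :=
  EquivRel eq_mod1 eq_mod1_refl eq_mod1_sym eq_mod1_trans.

Definition circle := {eq_quot eq_mod1}.

End Circle.

Section Manifold.
Variables (R : realType) (n : nat).

(* The coordinates (theta, x, y, z) on R^(2n+2); the lcs manifold mfd below is
   their quotient by Z x 0 x Z, and its tangent spaces are identified with
   coords. *)
Definition coords : normedModType R := (R * 'rV[R]_n * 'rV[R]_n * R)%type.

Definition mfd := (circle R * 'rV[R]_n * 'rV[R]_n * circle R)%type.

Definition mfd_proj (u : coords) : mfd :=
  (\pi_(circle R) u.1.1.1, u.1.1.2, u.1.2, \pi_(circle R) u.2).

Definition mfd_lift (p : mfd) : coords :=
  (repr p.1.1.1, p.1.1.2, p.1.2, repr p.2).

Lemma mfd_liftK : cancel mfd_lift mfd_proj.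
Proof. by case=> [[[? ?] ?] ?]; rewrite /mfd_proj /mfd_lift /= !reprK. Qed.

Lemma mfd_proj_eqP (u v : coords) : mfd_proj u = mfd_proj v <->
  [/\ u.1.1.1 - v.1.1.1 \is a Num.int, u.1.1.2 = v.1.1.2, u.1.2 = v.1.2 &
      u.2 - v.2 \is a Num.int].
Proof.
case: u v => [[[a x] y] z] [[[a' x'] y'] z'] /=; rewrite /mfd_proj /=; split.
  by move=> [/eqquotP aa' -> -> /eqquotP zz'].
by move=> [aa' -> -> zz']; congr (_, _, _, _); exact/eqquotP.
Qed.

Definition edot (u v : coords) : R :=
  u.1.1.1 * v.1.1.1 + \sum_j u.1.1.2 0 j * v.1.1.2 0 j
  + \sum_j u.1.2 0 j * v.1.2 0 j + u.2 * v.2.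

Definition enorm (u : coords) : R := Num.sqrt (edot u u).

Lemma edotC u v : edot u v = edot v u.
Proof.
rewrite /edot; congr (_ + _ + _ + _); rewrite 1?mulrC //;
by apply: eq_bigr => j _; rewrite mulrC.
Qed.

Lemma edotDl u v w : edot (u + v) w = edot u w + edot v w.
Proof.
rewrite /edot /= !mulrDl.
under eq_bigr do rewrite mxE mulrDl.
under [X in _ + _ + X + _]eq_bigr do rewrite mxE mulrDl.
by rewrite !big_split /=; ring.
Qed.

Lemma edotZl a u v : edot (a *: u) v = a * edot u v.
Proof.
rewrite /edot /=.
under eq_bigr do rewrite mxE -mulrA.
under [X in _ + _ + X + _]eq_bigr do rewrite mxE -mulrA.
by rewrite -!mulr_sumr /GRing.scale /=; ring.
Qed.

Lemma edot_ge0 u : 0 <= edot u u.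
Proof.
by rewrite /edot !addr_ge0 ?sumr_ge0// => *; rewrite -expr2 sqr_ge0.
Qed.

Lemma edot_ge_coords u :
  [/\ u.1.1.1 ^+ 2 <= edot u u, forall j, u.1.1.2 0 j ^+ 2 <= edot u u,
      forall j, u.1.2 0 j ^+ 2 <= edot u u & u.2 ^+ 2 <= edot u u].
Proof.
have t0 := sqr_ge0 u.1.1.1; have z0 := sqr_ge0 u.2.
have sq_sum (f : 'rV[R]_n) :
    0 <= \sum_j f 0 j * f 0 j /\
    forall j, f 0 j ^+ 2 <= \sum_j f 0 j * f 0 j.
  split=> [|j]; first by apply: sumr_ge0 => k _; rewrite -expr2 sqr_ge0.
  rewrite (bigD1 j)//= expr2 lerDl sumr_ge0// => k _.
  by rewrite -expr2 sqr_ge0.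
have [x0 xj] := sq_sum u.1.1.2; have [y0 yj] := sq_sum u.1.2.
rewrite /edot -!expr2; split; [lra| |  |lra].
  by move=> j; have := xj j; lra.
by move=> j; have := yj j; lra.
Qed.

Lemma edot_CauchySchwarz u v : edot u v <= enorm u * enorm v.
Proof.
have [v0|vneq0] := eqVneq (edot v v) 0.
  have := edot_ge_coords v; rewrite v0 => -[t0 x0 y0 z0].
  have sq0 (a : R) : a ^+ 2 <= 0 -> a = 0.
    by move=> a0; apply/eqP; rewrite -sqrf_eq0 eq_le a0 sqr_ge0.
  have -> : edot u v = 0.
    rewrite /edot (sq0 _ t0) (sq0 _ z0) !big1 ?mulr0 ?addr0// => j _.
      by rewrite (sq0 _ (y0 j)) mulr0.
    by rewrite (sq0 _ (x0 j)) mulr0.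
  by rewrite mulr_ge0// sqrtr_ge0.
have v0 : 0 < edot v v by rewrite lt_neqAle eq_sym vneq0 edot_ge0.
have := edot_ge0 (edot v v *: u + (- edot u v) *: v).
rewrite edotDl !edotZl ![edot _ (_ + _)]edotC !edotDl !edotZl.
rewrite (edotC v u) => h.
have {}h : edot u v ^+ 2 <= edot u u * edot v v.
  rewrite -subr_ge0 -(pmulr_rge0 _ v0); apply: le_trans h _.
  by rewrite le_eqVlt; apply/orP; left; apply/eqP; ring.
rewrite -sqrtrM ?edot_ge0//; apply: le_trans (ler_norm _) _.
by rewrite -sqrtr_sqr ler_sqrt// mulr_ge0// edot_ge0.
Qed.

Lemma enorm_triangle u v : enorm (u + v) <= enorm u + enorm v.
Proof.
rewrite -(ler_pXn2r (n := 2))// ?nnegrE ?addr_ge0 ?sqrtr_ge0//.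
rewrite sqr_sqrtr ?edot_ge0// edotDl ![edot _ (_ + _)]edotC !edotDl (edotC v u).
have := edot_CauchySchwarz u v.
have <- : enorm u ^+ 2 = edot u u by rewrite sqr_sqrtr// edot_ge0.
have <- : enorm v ^+ 2 = edot v v by rewrite sqr_sqrtr// edot_ge0.
by move=> h; rewrite sqrrD; lra.
Qed.

Lemma enorm0 : enorm 0 = 0.
Proof. by rewrite /enorm -(scale0r 0) edotZl mul0r sqrtr0. Qed.

Lemma enormN u : enorm (- u) = enorm u.
Proof.
by rewrite /enorm -scaleN1r edotZl edotC edotZl; congr Num.sqrt; ring.
Qed.

(* The distance induced on the quotient by the Euclidean one. *)
Definition mfd_dist (p q : mfd) : R :=
  inf [set enorm (v - u) | u in mfd_proj @^-1` [set p] &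
                           v in mfd_proj @^-1` [set q]].

Lemma mfd_dist_le u v : mfd_dist (mfd_proj u) (mfd_proj v) <= enorm (v - u).
Proof.
apply: ge_inf; last by exists u => //; exists v.
by exists 0 => _ [u' _ [v' _ <-]]; exact: sqrtr_ge0.
Qed.

Lemma mfd_dist_adherent p q e : 0 < e -> exists u v,
  [/\ mfd_proj u = p, mfd_proj v = q & enorm (v - u) < mfd_dist p q + e].
Proof.
move=> e0; have [||_ [u up [v vq <-]] uv] := @inf_adherent _
    [set enorm (v - u) | u in mfd_proj @^-1` [set p] &
                         v in mfd_proj @^-1` [set q]] e.
- by [].
- split; last by exists 0 => _ [u' _ [v' _ <-]]; exact: sqrtr_ge0.
  exists (enorm (mfd_lift q - mfd_lift p)), (mfd_lift p).
    exact: mfd_liftK.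
  by exists (mfd_lift q) => //; exact: mfd_liftK.
- by exists u, v.
Qed.

Lemma mfd_distxx p : mfd_dist p p = 0.
Proof.
apply/eqP; rewrite eq_le; apply/andP; split.
  by rewrite -[p]mfd_liftK (le_trans (mfd_dist_le _ _))// subrr enorm0.
apply: lb_le_inf; last by move=> _ [u _ [v _ <-]]; exact: sqrtr_ge0.
exists (enorm (mfd_lift p - mfd_lift p)), (mfd_lift p); first exact: mfd_liftK.
by exists (mfd_lift p) => //; exact: mfd_liftK.
Qed.

Lemma mfd_dist_sym p q : mfd_dist p q = mfd_dist q p.
Proof.
rewrite /mfd_dist; congr inf; apply/seteqP; split => _ [u up [v vq <-]];
by exists v => //; exists u => //; rewrite -enormN opprB.
Qed.

Lemma mfd_proj_translate u v w :
  mfd_proj u = mfd_proj v -> mfd_proj (w + (u - v)) = mfd_proj w.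
Proof.
move=> /mfd_proj_eqP[tuv xuv yuv zuv]; apply/mfd_proj_eqP => /=.
by rewrite xuv yuv !subrr !addr0 ![_ + _ - _]addrC !addKr.
Qed.

Lemma mfd_dist_triangle q p r : mfd_dist p r <= mfd_dist p q + mfd_dist q r.
Proof.
apply/ler_addgt0Pl => e e0; have e20 : 0 < e / 2 by rewrite divr_gt0.
have [u [v [<- vq uv]]] := mfd_dist_adherent p q e20.
have [v' [w [v'q <- vw]]] := mfd_dist_adherent q r e20.
have vv' : mfd_proj v = mfd_proj v' by rewrite vq v'q.
have := mfd_dist_le u (w + (v - v')); rewrite (mfd_proj_translate w vv').
have -> : w + (v - v') - u = (w - v') + (v - u).
  by rewrite -!addrA; congr (_ + _); rewrite addrCA.
have := enorm_triangle (w - v') (v - u).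
by move: uv vw; lra.
Qed.

Lemma int_of_small (a : R) :
  (forall e, 0 < e -> exists2 b, b - a \is a Num.int & `|b| < e) ->
  a \is a Num.int.
Proof.
move=> ha; have [b ba b2] := ha (1 / 2) ltac:(lra).
have [b0|bneq0] := eqVneq b 0; first by rewrite -rpredN -[- a]add0r -b0.
have [c ca cb] := ha `|b| ltac:(by rewrite normr_gt0).
have cbint : c - b \is a Num.int.
  by rewrite -(subrKA a) rpredD// -opprB rpredN.
have [cb0|cbneq0] := eqVneq (c - b) 0.
  by move: cb; rewrite (subr0_eq cb0) ltxx.
have := norm_intr_ge1 cbint cbneq0; have := ler_normB c b.
by move=> h1 h2; exfalso; lra.
Qed.

Lemma mfd_dist_positivity p q : mfd_dist p q = 0 -> p = q.
Proof.
move=> pq0; rewrite -[p]mfd_liftK -[q]mfd_liftK; apply/esym/mfd_proj_eqP.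
set u0 := mfd_lift p; set v0 := mfd_lift q.
have small e : 0 < e -> exists2 w : coords,
    [/\ w.1.1.1 - (v0 - u0).1.1.1 \is a Num.int, w.1.1.2 = (v0 - u0).1.1.2,
        w.1.2 = (v0 - u0).1.2 & w.2 - (v0 - u0).2 \is a Num.int] &
    edot w w < e ^+ 2.
  move=> e0; have [u [v [up vq]]] := mfd_dist_adherent p q e0.
  rewrite pq0 add0r => uv; exists (v - u); last first.
    by rewrite -(sqr_sqrtr (edot_ge0 _)) ltr_pXn2r// nnegrE ?sqrtr_ge0// ltW.
  move: up vq; rewrite -[p]mfd_liftK -[q]mfd_liftK -/u0 -/v0.
  move=> /mfd_proj_eqP[tu xu yu zu] /mfd_proj_eqP[tv xv yv zv] /=.
  have intB (b c b' c' : R) : b - b' \is a Num.int -> c - c' \is a Num.int ->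
      b - c - (b' - c') \is a Num.int.
    move=> bb' cc'; have -> : b - c - (b' - c') = (b - b') - (c - c') by ring.
    exact: rpredB.
  by rewrite xu xv yu yv; split => //; exact: intB.
have lt_sq (a e : R) : 0 < e -> a ^+ 2 < e ^+ 2 -> `|a| < e.
  by move=> e0; rewrite -real_normK ?num_real// ltr_pXn2r// nnegrE ltW.
have sq0 (a : R) : (forall e, 0 < e -> a ^+ 2 < e ^+ 2) -> a = 0.
  move=> ha; have [//|aneq0] := eqVneq a 0.
  have a0 : 0 < `|a| by rewrite normr_gt0.
  by have := ha _ a0; rewrite real_normK ?num_real// ltxx.
split.
- apply: int_of_small => e e0; have [w [wt _ _ _] we] := small e e0.
  exists w.1.1.1 => //; apply: lt_sq => //.
  by have [h _ _ _] := edot_ge_coords w; exact: le_lt_trans h we.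
- apply/eqP; rewrite -subr_eq0; apply/eqP/rowP => j; rewrite [RHS]mxE.
  apply: sq0 => e e0; have [w [_ wx _ _] we] := small e e0.
  have -> : (v0.1.1.2 - u0.1.1.2) 0 j = w.1.1.2 0 j by rewrite wx.
  by have [_ h _ _] := edot_ge_coords w; exact: le_lt_trans (h j) we.
- apply/eqP; rewrite -subr_eq0; apply/eqP/rowP => j; rewrite [RHS]mxE.
  apply: sq0 => e e0; have [w [_ _ wy _] we] := small e e0.
  have -> : (v0.1.2 - u0.1.2) 0 j = w.1.2 0 j by rewrite wy.
  by have [_ _ h _] := edot_ge_coords w; exact: le_lt_trans (h j) we.
- apply: int_of_small => e e0; have [w [_ _ _ wz] we] := small e e0.
  exists w.2 => //; apply: lt_sq => //.
  by have [_ _ _ h] := edot_ge_coords w; exact: le_lt_trans h we.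
Qed.

HB.instance Definition _ := Choice.on mfd.
HB.instance Definition _ := isMetric.Build R mfd
  mfd_distxx mfd_dist_positivity mfd_dist_sym mfd_dist_triangle.

Definition form0 := mfd -> R.
Definition form1 := mfd -> coords -> R.
Definition form2 := mfd -> coords -> coords -> R.

(* Any other choice of preimage of p gives the same derivative. *)
Definition mderive (f : form0) (p : mfd) (v : coords) : R :=
  'D_v (f \o mfd_proj) (mfd_lift p).

Definition ext_d0 (f : form0) : form1 := mderive f.

(* The bracket term vanishes as u and v are constant vector fields. *)
Definition ext_d1 (s : form1) : form2 := fun p u v =>
  mderive (s^~ v) p u - mderive (s^~ u) p v.

Definition wedge_form (a b : form1) : form2 := fun p u v =>
  a p u * b p v - a p v * b p u.

Definition lee_d0 (eta : form1) (f : form0) : form1 := fun p v =>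
  ext_d0 f p v - f p * eta p v.

Definition lee_d1 (eta s : form1) : form2 := fun p u v =>
  ext_d1 s p u v - wedge_form eta s p u v.

Definition dtheta : form1 := fun _ v => v.1.1.1.

Definition lee_form : form1 := fun p v => - dtheta p v.

Definition alpha0 : form1 := fun p v =>
  \sum_j (p.1.1.2 0 j * v.1.2 0 j - p.1.2 0 j * v.1.1.2 0 j) / 2 - v.2.

Definition omega : form2 := lee_d1 lee_form alpha0.

(* A time-dependent function or vector field is smooth if its pullback to the
   cover R x R^(2n+2) of R x mfd is. *)
Definition smooth_family (V : normedModType R) (f : R -> mfd -> V) :=
  smooth (fun tu : (R * coords)%type => f tu.1 (mfd_proj tu.2)).

Definition compactly_supported (V : normedModType R) (f : R -> mfd -> V) :=
  exists2 K : set mfd, compact K & forall t p, ~ K p -> f t p = 0.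

(* The velocity of a curve in mfd is that of its lifts to R^(2n+2). *)
Definition is_flow (X : R -> mfd -> coords) (phi : R -> mfd -> mfd) :=
  (forall p, phi 0 p = p) /\
  forall p, exists2 c : R -> coords, (forall t, mfd_proj (c t) = phi t p) &
    forall t : R, is_derive t 1 c (X t (phi t p)).

Definition hamiltonian (X : R -> mfd -> coords) (H : R -> mfd -> R) :=
  forall t p v, omega p (X t p) v = - lee_d0 lee_form (H t) p v.

(* The time-one maps, being compactly supported diffeomorphisms, are uniform
   homeomorphisms of mfd. *)
Definition Hamc : set (uhomeo mfd) :=
  [set f | exists X H phi,
    [/\ smooth_family X, compactly_supported X, smooth_family H,
        hamiltonian X H & is_flow X phi /\ uhfun f = phi 1]].

End Manifold.

Arguments Hamc R n : clear implicits.

(* Main.v *)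
(* Lifting the isotopy that defines h in Ham^c to R^(2n+2) gives a continuous
   real function d_h that measures the displacement of the coordinate theta
   under h; it is bounded, vanishes far away in R^(2n), and is a cocycle.  Hence
   the Birkhoff sums of d_g along g and of d_(hgh^-1) along hgh^-1 differ by a
   bounded coboundary.  As d_h is determined mod 1 by h and vanishes at infinity,
   it depends continuously on h in the C^0-topology.  So if conjugates of g
   accumulate at the identity, the Birkhoff sums of d_g grow slower than eps * m
   for every eps > 0.

   On the other hand lcs Hamiltonian flows need not preserve volume.  For
   H = chi(|x|^2 + |y|^2) sin(2 pi z) / (2 pi), with a nonincreasing bump function
   chi, the circle {x = y = z = 0} attracts and theta increases along it.  Hence
   some neighbourhood A of this circle is mapped well inside itself by the time-1
   map f, and d_f is bounded below on A by a positive constant.  Both properties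
   persist for maps close to f, so if conjugates of g accumulate at f then some
   Birkhoff sums of d_g grow linearly: the class of g cannot be dense. *)

Require Import Defs.
From HB Require Import structures.
From mathcomp Require Import all_boot all_order all_algebra.
From mathcomp Require Import ring lra.
From mathcomp Require Import all_classical all_reals all_analysis.

Set Implicit Arguments.
Unset Strict Implicit.
Unset Printing Implicit Defensive.

Import Order.TTheory GRing.Theory Num.Theory.
Import numFieldNormedType.Exports.

Local Open Scope classical_set_scope.
Local Open Scope ring_scope.

(** * Curves in products of lines *)

Lemma is_derive_cvg (R : realType) (U V : normedModType R) (f : U -> V) x v df :
  is_derive x v f df <-> h^-1 *: (f (h *: v + x) - f x) @[h --> 0^'] --> df.
Proof.
split=> [[fx <-]|fx]; first exact: fx.
by apply: DeriveDef; [apply/cvg_ex; exists df | apply: cvg_lim].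
Qed.

Lemma is_derive_pair (R : realType) (U V W : normedModType R)
  (f : U -> V * W) x v (df : V * W) :
  is_derive x v f df <->
  is_derive x v (fun y => (f y).1) df.1 /\ is_derive x v (fun y => (f y).2) df.2.
Proof.
rewrite !is_derive_cvg; split=> [h|[h1 h2]].
  split.
  - exact: (cvg_comp _ _ h (@cvg_fst _ _ (nbhs df.1) (nbhs df.2) _)).
  - exact: (cvg_comp _ _ h (@cvg_snd _ _ (nbhs df.1) (nbhs df.2) _)).
case: df h1 h2 => a b /= h1 h2; have h := cvg_pair h1 h2.
set q := fun h => _; suff -> : q = fun h => (h^-1 *: ((f (h *: v + x)).1 - (f x).1),
  h^-1 *: ((f (h *: v + x)).2 - (f x).2)) by exact: h.
by apply/funext => k; rewrite [LHS]surjective_pairing.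
Qed.

Lemma is_derive_rV (R : realType) (U : normedModType R) n
  (f : U -> 'rV[R]_n) x v (df : 'rV[R]_n) :
  is_derive x v f df <-> forall j, is_derive x v (fun y => f y 0 j) (df 0 j).
Proof.
split=> [[fx <-] j|fx].
  rewrite derive_mx// mxE; apply: derivableP.
  by move/derivable_mxP: fx; exact.
have dx : derivable f x v.
  by apply/derivable_mxP => i j; rewrite (ord1 i); have [] := fx j.
apply: DeriveDef => //; rewrite derive_mx//.
by apply/rowP => j; rewrite mxE; have [_ ->] := fx j.
Qed.

Lemma rV_norm_le (R : realType) n (v : 'rV[R]_n) (b : R) : 0 <= b ->
  (`|v| <= b) <-> (forall j, `|v 0 j| <= b).
Proof.
move=> b0; rewrite [`|v|]/Num.Def.normr/= mx_normrE; split=> [h j|h].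
  by apply: le_trans h; exact: (le_bigmax _ (fun ij => `|v ij.1 ij.2|) (0, j)).
by apply: bigmax_le => // -[i j] _ /=; rewrite (ord1 i).
Qed.

Lemma pair_norm_le (R : realType) (V W : normedModType R) (v : V * W) (b : R) :
  (`|v| <= b) <-> `|v.1| <= b /\ `|v.2| <= b.
Proof. by rewrite prod_normE ge_max; split=> [/andP|[-> ->]]. Qed.

Lemma is_derive_mull (R : realType) (f : R -> R) (c a t : R) :
  is_derive (t * c) 1 f a -> is_derive t 1 (fun s => f (s * c)) (a * c).
Proof.
move=> fa; have mc : is_derive t 1 (fun s : R => s * c) c.
  have := @is_deriveM _ _ (@id R) (cst c) t 1 1 0.
  move=> /(_ (is_derive_id _ _) (is_derive_cst _ _ _)) h.
  apply: (is_derive_eq h).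
  by rewrite /cst /= scaler0 add0r /GRing.scale /= mulr1.
exact: (@is_derive1_comp _ f (fun s => s * c) t a c fa mc).
Qed.

(* The facts about curves in V that Picard iteration uses; unlike the available
   completeness instances, they pass to finite products. *)
Record ode_space (R : realType) (V : normedModType R) : Prop := OdeSpace {
  primitive_exists : forall g : R -> V, continuous g ->
    exists2 G : R -> V, G 0 = 0 & forall t : R, is_derive t 1 G (g t);
  mean_value : forall (w w' : R -> V) (g g' : R -> R) (t : R),
    (forall s : R, is_derive s 1 w (w' s)) ->
    (forall s : R, is_derive s 1 g (g' s)) ->
    (forall tau, 0 <= tau <= 1 -> `|w' (tau * t)| <= g' (tau * `|t|)) ->
    `|w t - w 0| <= g `|t| - g 0;
  geometric_limit : forall (v : nat -> V) (A : R),
    (forall k, `|v k.+1 - v k| <= A / 2 ^+ k) ->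
    exists l, forall k, `|l - v k| <= 2 * A / 2 ^+ k }.

(** * Primitives, mean values and geometric limits on the real line *)

Section RealLine.
Variable R : realType.

Lemma is_derive1_continuous (f : R -> R) (df : R -> R) (a b : R) :
  (forall s, a <= s <= b -> is_derive s 1 f (df s)) ->
  {within `[a, b], continuous f}.
Proof.
move=> fd; apply: derivable_within_continuous => x; rewrite in_itv /= => xab.
by have [] := fd x xab.
Qed.

(** The integral from [-N] is a primitive only to the right of [-N]. The primitives for different
    [N], shifted to vanish at [0], agree on their common domain and are glued. *)
Lemma real_primitive (g : R -> R) : continuous g ->
  exists2 G : R -> R, G 0 = 0 & forall t : R, is_derive t 1 G (g t).
Proof.
move=> cg.
pose F (N : R) x := (\int[lebesgue_measure]_(t in [set` `[- N, x]]) (g t))%R.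
have dF (N x : R) : - N < x -> is_derive x 1 (F N) (g x).
  move=> Nx; have := @continuous_FTC1_closed R g (- N) x (x + 1).
  have h : (@lebesgue_measure R).-integrable `[- N, x + 1] (EFin \o g).
    apply: continuous_compact_integrable; first exact: segment_compact.
    exact: continuous_subspaceT.
  move=> /(_ ltac:(lra) h Nx (cg x))[d1 d2].
  by apply: DeriveDef; [exact: d1 | rewrite -derive1E; exact: d2].
pose G (N x : R) := F N x - F N 0.
have dG (N x : R) : - N < x -> is_derive x 1 (G N) (g x).
  move=> Nx; have h := @is_deriveB _ _ _ (F N) (cst (F N 0)) x 1 _ _ (dF N x Nx)
    (is_derive_cst _ _ _).
  by apply: (is_derive_eq h); rewrite subr0.
have G0 N : G N 0 = 0 by rewrite /G subrr.
have dGM (N M x : R) : - N < x -> - M < x -> is_derive x 1 (G N - G M) 0.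
  move=> Nx Mx; have h := is_deriveB (dG N x Nx) (dG M x Mx).
  by apply: (is_derive_eq h); rewrite subrr.
have GG (N M x : R) : `|x| < N -> `|x| < M -> G N x = G M x.
  rewrite !ltr_norml => /andP[N1 N2] /andP[M1 M2].
  have d s : Num.min 0 x <= s <= Num.max 0 x -> is_derive s 1 (G N - G M) 0.
    rewrite ge_min le_max => /andP[h1 h2].
    by apply: dGM; case/orP: h1 => h1; case/orP: h2 => h2; lra.
  have := MVT_segment (df := cst 0) (f := G N - G M)
    (a := Num.min 0 x) (b := Num.max 0 x).
  case=> [||| c _].
  - by rewrite ge_min !le_max lexx.
  - by move=> s; rewrite in_itv/= => /andP[h1 h2]; apply: d; rewrite !ltW.
  - exact: (is_derive1_continuous d).
  - rewrite /= mul0r.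
    have e y : (G N - G M) y = G N y - G M y by [].
    have [x0|x0] := leP 0 x; rewrite !e !G0.
      by move=> h; lra.
    by move=> h; lra.
exists (fun x => G (`|x| + 1) x); first by rewrite G0.
(* For [y] within distance 1 of [t], the choice [N = |y| + 1] gives the same value as the fixed
   choice [N = |t| + 2]. *)
move=> t; apply: (@near_eq_is_derive _ _ _ (G (`|t| + 2))).
- apply: filterS (nbhsx_ballx t (1 : R) ltr01) => y; rewrite -ball_normE /= => yt.
  apply: GG; last by lra.
  by have := ler_normB t (t - y); rewrite subKr; lra.
- by apply: dG; have := ler_norm (- t); rewrite normrN; lra.
Qed.

(** This is the mean value theorem on [0, 1] for [g (s |t|) - e w (s t)] with [e = 1] and [e = -1];
    scaling time by [t] covers negative times as well. *)
Lemma real_mean_value (w w' g g' : R -> R) (t : R) :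
    (forall s : R, is_derive s 1 w (w' s)) ->
    (forall s : R, is_derive s 1 g (g' s)) ->
    (forall tau, 0 <= tau <= 1 -> `|w' (tau * t)| <= g' (tau * `|t|)) ->
    `|w t - w 0| <= g `|t| - g 0.
Proof.
move=> dw dg wg.
have key (e : R) : `|e| = 1 -> e * (w t - w 0) <= g `|t| - g 0.
  move=> e1.
  pose f : R -> R := (fun s : R => g (s * `|t|)) - e *: (fun s : R => w (s * t)).
  have df (s : R) : is_derive s 1 f (g' (s * `|t|) * `|t| - e * (w' (s * t) * t)).
    apply: is_deriveB; first exact: is_derive_mull (dg _).
    exact: (is_deriveZ e (is_derive_mull (dw (s * t)))).
  have cf : {within `[0, 1], continuous f}.
    by apply: is_derive1_continuous => s _; exact: df.
  have [c cc] := MVT ltr01 (fun s _ => df s) cf.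
  move: cc; rewrite in_itv/= => /andP[c0 c1].
  have -> : f 1 - f 0 = g `|t| - g 0 - e * (w t - w 0).
    by rewrite /f !fctE /= /GRing.scale /= !mul1r !mul0r; ring.
  rewrite subr0 mulr1 => h; rewrite -subr_ge0 h subr_ge0.
  have cc : 0 <= c <= 1 by rewrite !ltW.
  apply: le_trans (ler_norm _) _; rewrite !normrM e1 mul1r.
  by rewrite ler_wpM2r//; exact: wg.
by rewrite ler_norml; have := key 1 (normr1 _); have := key (-1) (normrN1 _); lra.
Qed.

(** With [e k = 2 A / 2 ^ k] the intervals from [v k - e k] to [v k + e k] are nested; the limit is
    the supremum of their left ends. *)
Lemma real_geometric_limit (v : nat -> R) (A : R) :
  (forall k, `|v k.+1 - v k| <= A / 2 ^+ k) ->
  exists l, forall k, `|l - v k| <= 2 * A / 2 ^+ k.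
Proof.
move=> vA; pose e k := 2 * A / 2 ^+ k.
have eS k : e k - e k.+1 = A / 2 ^+ k.
  by rewrite /e exprS; field; rewrite expf_neq0// pnatr_eq0.
have step k : v k - e k <= v k.+1 - e k.+1 /\ v k.+1 + e k.+1 <= v k + e k.
  by have := vA k; rewrite -eS ler_norml => /andP[h1 h2]; split; lra.
have A0 : 0 <= A by have := le_trans (normr_ge0 _) (vA 0); rewrite expr0 divr1.
have e0 k : 0 <= e k by rewrite /e !mulr_ge0// invr_ge0 exprn_ge0.
have lo k j : v k - e k <= v (k + j)%N - e (k + j)%N.
  by elim: j => [|j IH]; rewrite ?addn0// addnS (le_trans IH)//; case: (step (k + j)%N).
have hi k j : v (k + j)%N + e (k + j)%N <= v k + e k.
  elim: j => [|j IH]; rewrite ?addn0// addnS; apply: le_trans IH.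
  by case: (step (k + j)%N).
have lohi k j : v k - e k <= v j + e j.
  have := lo k j; have := hi j k; rewrite [(j + k)%N]addnC.
  by have := e0 (k + j)%N; lra.
exists (sup [set v k - e k | k in [set: nat]]) => k; rewrite ler_norml; apply/andP.
split.
  suff : v k - e k <= sup [set v k - e k | k in [set: nat]] by rewrite -/(e k); lra.
  apply: ub_le_sup; last by exists k.
  by exists (v 0 + e 0) => _ [j _ <-].
suff : sup [set v k - e k | k in [set: nat]] <= v k + e k by rewrite -/(e k); lra.
apply: ge_sup; first by exists (v 0 - e 0), 0%N.
by move=> _ [j _ <-].
Qed.

Lemma real_ode_space : ode_space (R : normedModType R).
Proof.
split; [exact: real_primitive | exact: real_mean_value |
        exact: real_geometric_limit].
Qed.

End RealLine.

(** * Passage to finite products, coordinate by coordinate in the maximum norm *)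

Section Products.
Variable R : realType.

Lemma pair_ode_space (V W : normedModType R) :
  ode_space V -> ode_space W -> ode_space (V * W)%type.
Proof.
move=> oV oW; split.
- move=> g cg.
  have [|G1 G10 dG1] := primitive_exists oV (g := fun t => (g t).1).
    by move=> t; apply: (cvg_comp _ _ (cg t)); exact: cvg_fst.
  have [|G2 G20 dG2] := primitive_exists oW (g := fun t => (g t).2).
    by move=> t; apply: (cvg_comp _ _ (cg t)); exact: cvg_snd.
  exists (fun t => (G1 t, G2 t)) => [|t]; first by rewrite G10 G20.
  by apply/is_derive_pair; split; [exact: dG1 | exact: dG2].
- move=> w w' g g' t dw dg wg; apply/pair_norm_le; split.
    apply: (mean_value oV (w := fun s => (w s).1)
      (w' := fun s => (w' s).1) _ dg).
      by move=> s; have /is_derive_pair[] := dw s.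
    by move=> tau /wg /pair_norm_le[].
  apply: (mean_value oW (w := fun s => (w s).2)
    (w' := fun s => (w' s).2) _ dg).
    by move=> s; have /is_derive_pair[] := dw s.
  by move=> tau /wg /pair_norm_le[].
- move=> v A vA.
  have [|l1 h1] := @geometric_limit _ _ oV (fun k => (v k).1) A.
    by move=> k; have /pair_norm_le[] := vA k.
  have [|l2 h2] := @geometric_limit _ _ oW (fun k => (v k).2) A.
    by move=> k; have /pair_norm_le[] := vA k.
  by exists (l1, l2) => k; apply/pair_norm_le; split; [exact: h1|exact: h2].
Qed.

Lemma rV_ode_space n : ode_space 'rV[R]_n.
Proof.
split.
- move=> g cg.
  have /choice[G hG] : forall j : 'I_n, exists G : R -> R, G 0 = 0 /\
      forall t : R, is_derive t 1 G (g t 0 j).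
    move=> j; have [|G] := @real_primitive R (fun t => g t 0 j); last by exists G.
    move=> t; exact: (cvg_comp _ _ (cg t) (@coord_continuous _ 1 n 0 j (g t))).
  exists (fun t => \row_j G j t).
    by apply/rowP => j; rewrite !mxE; case: (hG j).
  move=> t; apply/is_derive_rV => j.
  under eq_fun do rewrite mxE.
  by case: (hG j).
- move=> w w' g g' t dw dg wg.
  (* [rV_norm_le] asks for a nonnegative bound; the mean value inequality for the zero curve
     supplies it. *)
  have g0 : 0 <= g `|t| - g 0.
    have := @real_mean_value R (cst 0) (cst 0) g g' t
      (fun s => is_derive_cst 0 s 1) dg.
    rewrite /= subrr normr0; apply => tau /wg.
    by apply: le_trans.
  apply/(rV_norm_le _ g0) => j; rewrite !mxE.
  apply: (@real_mean_value _ (fun s => w s 0 j) (fun s => w' s 0 j) _ _ _ _ dg).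
    by move=> s; move/is_derive_rV: (dw s).
  move=> tau h; have := wg _ h => b.
  have b0 := le_trans (normr_ge0 _) b.
  by move/(rV_norm_le _ b0) : b.
- move=> v A vA.
  have A0 : 0 <= A by have := le_trans (normr_ge0 _) (vA 0); rewrite expr0 divr1.
  have b0 k : 0 <= A / 2 ^+ k by rewrite divr_ge0// exprn_ge0.
  have /choice[l hl] : forall j : 'I_n, exists l,
      forall k, `|l - v k 0 j| <= 2 * A / 2 ^+ k.
    move=> j; apply: real_geometric_limit => k.
    by have /(rV_norm_le _ (b0 k)) := vA k => /(_ j); rewrite !mxE.
  exists (\row_j l j) => k.
  have b2 : 0 <= 2 * A / 2 ^+ k by rewrite -mulrA mulr_ge0.
  by apply/(rV_norm_le _ b2) => j; rewrite !mxE.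
Qed.

Lemma coords_ode_space n : ode_space (coords R n).
Proof.
apply: pair_ode_space; last exact: real_ode_space.
apply: pair_ode_space; last exact: rV_ode_space.
apply: pair_ode_space; last exact: rV_ode_space.
exact: real_ode_space.
Qed.

End Products.

(** * Ordinary differential equations *)

Lemma ler_addgeom (R : realType) (x y C : R) :
  (forall k, x <= y + C / 2 ^+ k) -> x <= y.
Proof.
move=> h; have [//|yx] := leP x y; exfalso.
pose d := x - y; have d0 : 0 < d by rewrite subr_gt0.
pose k := (Num.truncn (C / d)).+1.
have Ck : C / d < 2 ^+ k.
  apply: lt_le_trans (truncnS_gt _) _.
  by rewrite -natrX ler_nat ltnW// ltn_expl.
have k0 : 0 < 2 ^+ k :> R by rewrite exprn_gt0.
have := h k; rewrite -lerBlDl -/d ler_pdivlMr// => hk.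
by move: Ck; rewrite ltr_pdivrMr// mulrC; lra.
Qed.

Lemma is_derive_translate (R : realType) (V : normedModType R) (f : R -> V) (s t : R) (d : V) :
  is_derive (t + s) 1 f d -> is_derive t 1 (fun x => f (x + s)) d.
Proof.
move=> /is_derive_cvg h; apply/is_derive_cvg.
by under eq_fun do rewrite -addrA.
Qed.

Lemma is_derive_id_continuous (R : realType) (V : normedModType R) (f f' : R -> V) :
  (forall t : R, is_derive t 1 f (f' t)) -> continuous f.
Proof.
move=> df t; apply/differentiable_continuous/derivable1_diffP.
by have [] := df t.
Qed.

Lemma lipschitz_continuous (R : realType) (V W : normedModType R) (f : V -> W) (L : R) :
  (forall x y, `|f x - f y| <= L * `|x - y|) -> continuous f.
Proof.
move=> fL x; apply/cvgrPdist_le => e e0.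
have L1 : 0 < `|L| + 1 by rewrite ltr_pwDr.
apply: filterS (nbhsx_ballx x (e / (`|L| + 1)) _) => [y|]; last by rewrite divr_gt0.
rewrite -ball_normE /= ltr_pdivlMr// => xy; apply: le_trans (fL x y) _.
apply: le_trans (ltW xy); rewrite mulrC ler_wpM2l//.
by have := ler_norm L; lra.
Qed.

Lemma expR_ge1 (R : realType) (x : R) : 0 <= x -> 1 <= expR x.
Proof. by move=> x0; apply: le_trans (expR_ge1Dx x); rewrite lerDl. Qed.

Section ODE.
Variables (R : realType) (V : normedModType R).
Hypothesis oV : ode_space V.

Lemma derive_bound_lipschitz (w w' : R -> V) (M : R) (s t : R) :
  (forall r : R, is_derive r 1 w (w' r)) ->
  (forall tau, 0 <= tau <= 1 -> `|w' (tau * (t - s) + s)| <= M) ->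
  `|w t - w s| <= M * `|t - s|.
Proof.
move=> dw wM.
have dg (r : R) : is_derive r 1 (fun x : R => x * M) M.
  rewrite -[X in is_derive _ _ _ X]mul1r.
  exact: (@is_derive_mull R id M 1 r (is_derive_id _ _)).
have := mean_value oV (t := t - s)
  (fun r => is_derive_translate (dw (r + s))) dg wM.
by rewrite subrK add0r mul0r subr0 mulrC.
Qed.

(** Against the weight [exp (2 L |t|)], integrating a speed bounded by [L] times the error halves
    the constant. This gives Gronwall and Picard on the whole line without cutting it into short
    intervals. *)
Lemma mean_value_exp (w w' : R -> V) (C L t : R) :
  (forall s : R, is_derive s 1 w (w' s)) ->
  (forall tau, 0 <= tau <= 1 ->
    `|w' (tau * t)| <= L * (C * expR (2 * L * (tau * `|t|)))) ->
  `|w t - w 0| <= C / 2 * (expR (2 * L * `|t|) - 1).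
Proof.
move=> dw wC.
pose g := fun s : R => C / 2 * expR (2 * L * s).
have dg (s : R) : is_derive s 1 g (L * (C * expR (2 * L * s))).
  have h : is_derive s 1 (fun s => expR (s * (2 * L))) (expR (s * (2 * L)) * (2 * L)).
    by apply: is_derive_mull; exact: is_derive_expR.
  have -> : g = (C / 2) *: (fun s : R => expR (s * (2 * L)) : R).
    by apply/funext => x; rewrite /g [2 * L * x]mulrC.
  apply: (is_derive_eq (is_deriveZ (C / 2) h)).
  by rewrite /GRing.scale /= [s * _]mulrC; field.
have := mean_value oV dw dg wC.
by rewrite /g mulr0 expR0 mulrBr.
Qed.

(** A crude bound [B0], from compactness of the segment from [0] to [t], is improved repeatedly:
    each use of [mean_value_exp] halves the excess over [2 |w 0|]. *)
Lemma gronwall (w w' : R -> V) (L t : R) : 0 <= L ->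
  (forall s : R, is_derive s 1 w (w' s)) ->
  (forall tau, 0 <= tau <= 1 -> `|w' (tau * t)| <= L * `|w (tau * t)|) ->
  `|w t| <= 2 * `|w 0| * expR (2 * L * `|t|).
Proof.
move=> L0 dw wL.
have cw := is_derive_id_continuous dw.
have [B0 hB] : exists B, forall tau, 0 <= tau <= 1 -> `|w (tau * t)| <= B.
  have [|c _ hc] := @EVT_max R (fun tau => `|w (tau * t)|) 0 1 ler01.
    have ct : continuous (fun s : R => s * t).
      apply: (@lipschitz_continuous _ _ _ _ `|t|) => x y.
      by rewrite -mulrBl normrM mulrC.
    apply: continuous_subspaceT => x; apply: (cvg_norm (V := V)).
    exact: (cvg_comp _ _ (ct x) (cw (x * t))).
  by exists `|w (c * t)| => tau tau01; apply: hc; rewrite in_itv.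
have B00 : 0 <= B0 by apply: le_trans (hB 0 _) => //; rewrite lexx ler01.
have step k tau : 0 <= tau <= 1 ->
    `|w (tau * t)| <= (2 * `|w 0| + B0 / 2 ^+ k) * expR (2 * L * (tau * `|t|)).
  elim: k tau => [|k IH] tau tau01.
    apply: le_trans (hB _ tau01) _; rewrite expr0 divr1.
    have e1 : 1 <= expR (2 * L * (tau * `|t|)).
      by rewrite expR_ge1// !mulr_ge0//; case/andP: tau01.
    apply: le_trans (ler_peMr _ e1) => //.
      by rewrite lerDr mulr_ge0.
    by rewrite addr_ge0// mulr_ge0.
  set C := 2 * `|w 0| + B0 / 2 ^+ k in IH.
  have CS : 2 * `|w 0| + B0 / 2 ^+ k.+1 = `|w 0| + C / 2.
    by rewrite /C exprS; field; rewrite expf_neq0// pnatr_eq0.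
  have [t0 t1] := andP tau01.
  have nt : `|tau * t| = tau * `|t| by rewrite normrM (ger0_norm t0).
  have := @mean_value_exp w w' C L (tau * t) dw.
  rewrite nt CS => /(_ _)/wrap[].
    move=> s /andP[s0 s1]; have st : 0 <= s * tau <= 1.
      by rewrite mulr_ge0//= mulr_ile1.
    rewrite !mulrA -[_ * `|t|]mulrA -!mulrA mulrA; apply: le_trans (wL _ st) _.
    rewrite ler_wpM2l//; apply: le_trans (IH _ st) _.
    by rewrite !mulrA.
  set E := expR _; move=> h.
  have E1 : 1 <= E by rewrite expR_ge1// !mulr_ge0.
  have := ler_normD (w (tau * t) - w 0) (w 0); rewrite subrK => h2.
  have h3 : `|w 0| <= `|w 0| * E by exact: ler_peMr.
  have C0 : 0 <= C by rewrite addr_ge0// ?mulr_ge0// divr_ge0// exprn_ge0.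
  by lra.
have h : forall k, `|w t| <= 2 * `|w 0| * expR (2 * L * `|t|) +
    (B0 * expR (2 * L * `|t|)) / 2 ^+ k.
  move=> k; have := step k 1; rewrite ler01 lexx !mul1r => /(_ isT).
  by move/le_trans; apply; rewrite le_eqVlt; apply/orP; left; apply/eqP; ring.
exact: ler_addgeom h.
Qed.

(** In the norm weighted by [exp (- 2 L |t|)] each Picard step halves distances, so a single
    iteration converges for all times at once. *)
Theorem picard (F : V -> V) (L M : R) : 0 < L ->
  (forall u v, `|F u - F v| <= L * `|u - v|) -> (forall u, `|F u| <= M) ->
  forall u, exists2 c : R -> V, c 0 = u & forall t : R, is_derive t 1 c (F (c t)).
Proof.
move=> L0 FL FM u.
have cF := lipschitz_continuous FL.
(* [P] selects a primitive vanishing at [0]; its value at a discontinuous function is arbitrary. *)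
have /choice[P hP] : forall g : R -> V, exists G : R -> V, continuous g ->
    G 0 = 0 /\ forall t : R, is_derive t 1 G (g t).
  move=> g; have [cg|ncg] := pselect (continuous g); last by exists (cst 0).
  by have [G G0 dG] := primitive_exists oV cg; exists G.
pose step (c : R -> V) : R -> V := cst u + P (F \o c).
have cFc c : continuous c -> continuous (F \o c).
  by move=> cc t; exact: (cvg_comp _ _ (cc t) (cF _)).
have dstep c : continuous c ->
    step c 0 = u /\ forall t : R, is_derive t 1 (step c) (F (c t)).
  move=> /cFc /hP [P0 dP]; split; first by rewrite /step !fctE P0 addr0.
  move=> t; have := is_deriveD (is_derive_cst u t 1) (dP t).
  by move/is_derive_eq; apply; rewrite add0r.
pose c k := iter k step (cst u).
have cc k : continuous (c k).
  elim: k => [|k IH] /=; first by move=> t; exact: cvg_cst.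
  by have [_ /is_derive_id_continuous] := dstep _ IH.
have c0 k : c k 0 = u by case: k => [//|k]; have [] := dstep _ (cc k).
have dc k (t : R) : is_derive t 1 (c k.+1) (F (c k t)) by have [_] := dstep _ (cc k).
have M0 : 0 <= M by apply: le_trans (FM u).
(* The speed bound is written as [M = L A], so that the first step already has the form integrated
   by [mean_value_exp]. *)
pose A := M / L; have A0 : 0 <= A by rewrite divr_ge0// ltW.
pose E (t : R) : R := expR (2 * L * `|t|).
have E1 (t : R) : 1 <= E t by rewrite expR_ge1// !mulr_ge0// ltW.
have geom k t : `|c k.+1 t - c k t| <= A * E t / 2 ^+ k.
  elim: k t => [|k IH] t.
    have := @mean_value_exp (c 1%N) (fun s => F (c 0%N s)) A L t (dc 0%N).
    rewrite c0 => /(_ _)/wrap[].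
      move=> tau /andP[t0 t1]; apply: le_trans (FM _) _.
      rewrite /A mulrA mulrCA divff ?gt_eqF// mulr1 ler_peMr// expR_ge1// !mulr_ge0//.
      exact: ltW.
    rewrite expr0 divr1 -/(E t) => /le_trans; apply.
    by have := mulr_ge0 A0 (le_trans ler01 (E1 t)); lra.
  have dd (s : R) : is_derive s 1 (c k.+2 - c k.+1) (F (c k.+1 s) - F (c k s)).
    exact: is_deriveB.
  have := @mean_value_exp _ _ (A / 2 ^+ k) L t dd.
  rewrite !fctE !c0 subrr subr0 => /(_ _)/wrap[].
    move=> tau /andP[t0 t1]; apply: le_trans (FL _ _) _.
    rewrite ler_wpM2l ?(ltW L0)//; apply: le_trans (IH _) _.
    by rewrite /E normrM (ger0_norm t0) mulrAC.
  rewrite -/(E t) => /le_trans; apply.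
  have -> : A * E t / 2 ^+ k.+1 = A / 2 ^+ k / 2 * E t.
    by rewrite exprS; field; rewrite expf_neq0// pnatr_eq0.
  by rewrite ler_wpM2l ?gerBl// divr_ge0// divr_ge0// exprn_ge0.
have /choice[l hl] : forall t, exists l, forall k, `|l - c k t| <= 2 * (A * E t) / 2 ^+ k.
  by move=> t; apply: (geometric_limit oV) => k; exact: geom.
(* The limit inherits the Lipschitz constant [M] of the iterates; it is therefore continuous, and
   [dstep] applies to it. *)
have lL t s : `|l t - l s| <= M * `|t - s|.
  apply: (@ler_addgeom _ _ _ (2 * (A * E t) * 2 + 2 * (A * E s) * 2)) => k.
  have h1 := hl t k.+1; have h2 := hl s k.+1.
  have h3 : `|c k.+1 t - c k.+1 s| <= M * `|t - s|.
    by apply: (derive_bound_lipschitz (dc k)) => tau _; exact: FM.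
  have p0 : 0 < 2 ^+ k :> R by rewrite exprn_gt0.
  have : l t - l s = (l t - c k.+1 t) + (c k.+1 t - c k.+1 s) - (l s - c k.+1 s).
    by rewrite addrA subrK opprB addrA subrK.
  move=> ->; apply: le_trans (ler_normB _ _) _.
  have := ler_normD (l t - c k.+1 t) (c k.+1 t - c k.+1 s).
  have q0 : 0 <= (A * E t) / 2 ^+ k.
    by rewrite divr_ge0 ?(ltW p0)// mulr_ge0// (le_trans ler01).
  have q1 : 0 <= (A * E s) / 2 ^+ k.
    by rewrite divr_ge0 ?(ltW p0)// mulr_ge0// (le_trans ler01).
  have e1 r : 2 * (A * E r) / 2 ^+ k.+1 = (A * E r) / 2 ^+ k.
    by rewrite exprS; field; rewrite gt_eqF.
  rewrite e1 in h1; rewrite e1 in h2.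
  rewrite mulrDl [2 * _ * 2 / _](_ : _ = 4 * (A * E t / 2 ^+ k)); last by ring.
  rewrite [2 * _ * 2 / _](_ : _ = 4 * (A * E s / 2 ^+ k)); last by ring.
  by lra.
have [e0 de] := dstep l (lipschitz_continuous lL).
(* Both [step l t] and [l t] are within a multiple of [1 / 2 ^ k] of [c k.+1 t], for every [k]. *)
have el : step l = l.
  apply/funext => t; apply/eqP; rewrite -subr_eq0 -normr_le0.
  apply: (@ler_addgeom _ _ _ (3 * (A * E t))) => k; rewrite add0r.
  have dd (s : R) : is_derive s 1 (step l - c k.+1) (F (l s) - F (c k s)).
    exact: is_deriveB.
  have := @mean_value_exp _ _ (2 * A / 2 ^+ k) L t dd.
  rewrite !fctE e0 c0 subrr subr0 => /(_ _)/wrap[].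
    move=> tau /andP[t0 t1]; apply: le_trans (FL _ _) _.
    rewrite ler_wpM2l ?(ltW L0)//; apply: le_trans (hl _ _) _.
    by rewrite /E normrM (ger0_norm t0) mulrA mulrAC.
  rewrite -/(E t) => h; have hk := hl t k.+1.
  have -> : step l t - l t = (step l t - c k.+1 t) - (l t - c k.+1 t).
    by rewrite opprB addrA subrK.
  apply: le_trans (ler_normB _ _) _; apply: le_trans (lerD h hk) _.
  have p0 : 0 < 2 ^+ k :> R by rewrite exprn_gt0.
  have -> : 2 * (A * E t) / 2 ^+ k.+1 = A / 2 ^+ k * E t.
    by rewrite exprS; field; rewrite gt_eqF.
  have -> : 3 * (A * E t) / 2 ^+ k = A / 2 ^+ k * E t * 3 by ring.
  have -> : 2 * A / 2 ^+ k / 2 = A / 2 ^+ k by field; rewrite gt_eqF.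
  have q0 : 0 <= A / 2 ^+ k by rewrite divr_ge0// ltW.
  by have := mulr_ge0 q0 (le_trans ler01 (E1 t)); lra.
by exists l => [|t]; [rewrite -el | move: (de t); rewrite el].
Qed.

End ODE.

(** * Geometry of the quotient *)

Section Geometry.
Variables (R : realType) (n : nat).
Local Notation coords := (coords R n).
Local Notation mfd := (mfd R n).
Local Notation proj := (@mfd_proj R n).

Lemma coords_norm_le (u : coords) (b : R) : 0 <= b ->
  (`|u| <= b) <-> [/\ `|u.1.1.1| <= b, forall j, `|u.1.1.2 0 j| <= b,
    forall j, `|u.1.2 0 j| <= b & `|u.2| <= b].
Proof.
move=> b0; split.
  by move=> /pair_norm_le[/pair_norm_le[/pair_norm_le[h1 /(rV_norm_le _ b0) h2]
    /(rV_norm_le _ b0) h3] h4].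
move=> [h1 h2 h3 h4]; apply/pair_norm_le; split => //.
apply/pair_norm_le; split; last exact/(rV_norm_le _ b0).
by apply/pair_norm_le; split => //; exact/(rV_norm_le _ b0).
Qed.

(** The distance on [mfd] comes from the Euclidean norm, whereas [coords] carries the maximum norm;
    this lemma and the next compare the two. *)
Lemma norm_le_enorm (u : coords) : `|u| <= enorm u.
Proof.
have le (a : R) : a ^+ 2 <= edot u u -> `|a| <= enorm u.
  by move=> h; rewrite -sqrtr_sqr ler_sqrt// edot_ge0.
apply/coords_norm_le; first exact: sqrtr_ge0.
by have [h1 h2 h3 h4] := edot_ge_coords u; split=> [|j|j|]; exact: le.
Qed.

Lemma enorm_le_norm (u : coords) : enorm u <= (2 * n%:R + 2) * `|u|.
Proof.
have [h1 h2 h3 h4] := (coords_norm_le u (normr_ge0 u)).1 (lexx _).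
have sq (a : R) : `|a| <= `|u| -> a * a <= `|u| ^+ 2.
  by move=> h; rewrite -expr2 -real_normK ?num_real// ler_pXn2r// nnegrE.
have sum (f : 'rV[R]_n) : (forall j, `|f 0 j| <= `|u|) ->
    \sum_j f 0 j * f 0 j <= n%:R * `|u| ^+ 2.
  move=> hf; apply: le_trans (ler_sum _ (fun j _ => sq _ (hf j))) _.
  by rewrite sumr_const card_ord mulr_natl.
have c0 : 0 <= 2 * n%:R + 2 :> R by rewrite addr_ge0// mulr_ge0.
have c1 : 1 <= 2 * n%:R + 2 :> R.
  by have := ler0n R n; lra.
rewrite -(ler_pXn2r (n := 2))// ?nnegrE ?sqrtr_ge0 ?mulr_ge0//.
rewrite sqr_sqrtr ?edot_ge0// exprMn.
have e : edot u u <= (2 * n%:R + 2) * `|u| ^+ 2.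
  rewrite /edot; have := sq _ h1; have := sq _ h4; have := sum _ h2; have := sum _ h3.
  by lra.
apply: le_trans e _; rewrite ler_wpM2r ?exprn_ge0// expr2.
by rewrite ler_peMl.
Qed.

(** A nearly minimizing pair of lifts is moved by a deck translation so that it starts at the given
    [u]. *)
Lemma mfd_dist_lift (u : coords) (q : mfd) (e : R) :
  mfd_dist (proj u) q < e -> exists2 v, proj v = q & `|v - u| < e.
Proof.
move=> h; have [|u' [v [uu' vq uv]]] := @mfd_dist_adherent R n (proj u) q
  (e - mfd_dist (proj u) q); first by rewrite subr_gt0.
exists (v + (u - u')).
  by rewrite mfd_proj_translate.
apply: le_lt_trans (norm_le_enorm _) _.
have -> : v + (u - u') - u = v - u' by rewrite addrA addrAC addrK.
by move: uv; lra.
Qed.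

Lemma mfd_dist_le_norm (u v : coords) :
  mfd_dist (proj u) (proj v) <= (2 * n%:R + 2) * `|v - u|.
Proof. exact: le_trans (mfd_dist_le u v) (enorm_le_norm _). Qed.

Lemma mfd_ballE (p q : mfd) (e : R) : ball p e q <-> mfd_dist p q < e.
Proof. by rewrite ballEmdist. Qed.

Lemma mfd_proj_continuous : continuous proj.
Proof.
move=> u; apply/cvg_ballP => e e0.
have C0 : 0 < 2 * n%:R + 2 :> R by have := ler0n R n; lra.
apply: filterS (nbhsx_ballx u (e / (2 * n%:R + 2)) (divr_gt0 e0 C0)) => v.
rewrite -ball_normE /= ltr_pdivlMr// => uv; apply/mfd_ballE.
by apply: le_lt_trans (mfd_dist_le_norm u v) _; rewrite mulrC distrC.
Qed.

(** The projection is open: by [mfd_dist_lift], a point close to [proj u] has a lift close to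
    [u]. *)
Lemma mfd_continuousP (V : normedModType R) (f : mfd -> V) :
  continuous (f \o proj) -> continuous f.
Proof.
move=> cf p; rewrite -[p]mfd_liftK; set u := mfd_lift p.
move=> P /(cf u) /nbhs_ballP[d /= d0 hd]; apply/nbhs_ballP; exists d => //= q.
move=> /mfd_ballE /mfd_dist_lift [v <- uv]; apply: hd.
by rewrite -ball_normE /= distrC.
Qed.

Lemma mfd_compact_bounded (K : set mfd) : compact K ->
  exists2 r : R, 0 <= r & forall p, K p -> `|p.1.1.2| <= r /\ `|p.1.2| <= r.
Proof.
move=> cK; pose f (p : mfd) : ('rV[R]_n * 'rV[R]_n)%type := (p.1.1.2, p.1.2).
have cf : continuous f.
  apply: mfd_continuousP; apply: (@lipschitz_continuous _ _ _ _ 1) => u v.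
  rewrite mul1r /f /=; apply/pair_norm_le; split.
    by have /pair_norm_le[/pair_norm_le[/pair_norm_le[_]]] := lexx `|u - v|.
  by have /pair_norm_le[/pair_norm_le[_]] := lexx `|u - v|.
have : compact (f @` K).
  by apply: continuous_compact => //; exact: continuous_subspaceT.
move=> /compact_bounded /pinfty_ex_gt0[r _ hr]; exists `|r| => // p Kp.
have /pair_norm_le[h1 h2] : `|f p| <= `|r|.
  by apply: le_trans (ler_norm _); apply: hr; exists p.
by [].
Qed.

Lemma deck_box (u : coords) : exists2 v, proj v = proj u &
  [/\ 0 <= v.1.1.1 <= 1, v.1.1.2 = u.1.1.2, v.1.2 = u.1.2 & 0 <= v.2 <= 1].
Proof.
exists (u.1.1.1 - (Num.floor u.1.1.1)%:~R, u.1.1.2, u.1.2, u.2 - (Num.floor u.2)%:~R).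
  by apply/mfd_proj_eqP; split => //=; rewrite addrAC subrr sub0r rpredN intr_int.
have fl (a : R) : 0 <= a - (Num.floor a)%:~R <= 1.
  by have := floor_le a; have := lt_succ_floor a; rewrite intrD; lra.
by split => //=; exact: fl.
Qed.

(** A closed fundamental domain of the deck group, cut off at size [r] in the directions [x] and
    [y]. *)
Definition coord_box (r : R) : set coords :=
  let B := [set v : 'rV[R]_n | forall i, `[- r, r]%classic (v ord0 i)] in
  `[0, 1] `*` B `*` B `*` `[0, 1].

Lemma coord_box_compact (r : R) : compact (coord_box r).
Proof.
have cB : compact [set v : 'rV[R]_n | forall i, `[- r, r]%classic (v ord0 i)].
  apply: (@rV_compact R n (fun=> `[- r, r]%classic)) => i.
  exact: segment_compact.
apply: compact_setX; last exact: segment_compact.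
apply: compact_setX => //; apply: compact_setX => //.
exact: segment_compact.
Qed.

Lemma coord_box_cover (r : R) (u : coords) : `|u.1.1.2| <= r -> `|u.1.2| <= r ->
  exists2 v, coord_box r v & proj v = proj u.
Proof.
move=> h1 h2; have [v pv [v1 v2 v3 v4]] := deck_box u; exists v => //.
have Bh (w : 'rV[R]_n) : `|w| <= r -> forall i, `[- r, r]%classic (w ord0 i).
  move=> wr i; rewrite /= in_itv /= -ler_norml.
  apply: le_trans wr; exact: (rV_norm_le w (normr_ge0 w)).1.
split => /=; last by rewrite in_itv.
split => /=; last by rewrite v3; exact: Bh.
by split => /=; [rewrite in_itv | rewrite v2; exact: Bh].
Qed.

(** Deck translations bring every point where [f] may be nonzero into the compact [coord_box r]
    without changing the value of [f]. *)
Lemma periodic_bounded (V : normedModType R) (f : R * coords -> V) (r : R) :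
  continuous f ->
  (forall t u v, proj u = proj v -> f (t, u) = f (t, v)) ->
  (forall t u, ~ (`|u.1.1.2| <= r /\ `|u.1.2| <= r) -> f (t, u) = 0) ->
  exists2 B : R, 0 <= B & forall t u, 0 <= t <= 1 -> `|f (t, u)| <= B.
Proof.
move=> cf pf f0.
have cbox : compact (`[0, 1]%classic `*` coord_box r : set (R * coords)).
  by apply: compact_setX; [exact: segment_compact | exact: coord_box_compact].
have : compact (f @` (`[0, 1]%classic `*` coord_box r)).
  by apply: continuous_compact => //; exact: continuous_subspaceT.
move=> /compact_bounded /pinfty_ex_gt0[B _ hB]; exists `|B| => // t u t01.
have [[h1 h2]|h] := pselect (`|u.1.1.2| <= r /\ `|u.1.2| <= r); last first.
  by rewrite f0// normr0.
have [v bv pv] := coord_box_cover h1 h2.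
apply: le_trans (ler_norm _); rewrite -(pf t _ _ pv); apply: hB.
by exists (t, v) => //; split => //=; rewrite in_itv.
Qed.

End Geometry.

(** * Uniform bounds for compactly supported vector fields on the cover *)

Lemma is_derive_line (R : realType) (U V : normedModType R) (f : U -> V)
  (x v : U) (df : V) (tau : R) :
  is_derive (tau *: v + x) v f df ->
  is_derive tau 1 (fun s : R => f (s *: v + x)) df.
Proof.
move=> /is_derive_cvg h; apply/is_derive_cvg.
under eq_fun do rewrite [_%:A]mulr1 scalerDl -addrA.
exact: h.
Qed.

Lemma derive_translate (R : realType) (U V : normedModType R) (f : U -> V)
  (x v a : U) : 'D_v f (x + a) = 'D_v (fun y => f (y + a)) x.
Proof.
rewrite /derive; set q := fun h => _; set q' := fun h => _.
by have -> : q = q' by apply/funext => h; rewrite /q /q' /= addrA.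
Qed.

Section VectorFields.
Variables (R : realType) (n : nat).
Local Notation coords := (coords R n).
Local Notation mfd := (mfd R n).
Local Notation proj := (@mfd_proj R n).

Lemma coords_decomp (e : coords) :
  e = e.1.1.1 *: ((1, 0, 0, 0) : coords)
    + \sum_j e.1.1.2 0 j *: ((0, delta_mx 0 j, 0, 0) : coords)
    + \sum_j e.1.2 0 j *: ((0, 0, delta_mx 0 j, 0) : coords)
    + e.2 *: ((0, 0, 0, 1) : coords).
Proof.
have s1 (x : 'rV[R]_n) : \sum_j x 0 j *: ((0, delta_mx 0 j, 0, 0) : coords) = (0, x, 0, 0).
  rewrite [in RHS](row_sum_delta x).
  by apply: (big_ind2 (fun (a : coords) b => a = (0, b, 0, 0))) => // [a b c d -> ->|j _];
    congr (_, _, _, _); rewrite /= ?addr0 ?scaler0 ?mulr0.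
have s2 (x : 'rV[R]_n) : \sum_j x 0 j *: ((0, 0, delta_mx 0 j, 0) : coords) = (0, 0, x, 0).
  rewrite [in RHS](row_sum_delta x).
  by apply: (big_ind2 (fun (a : coords) b => a = (0, 0, b, 0))) => // [a b c d -> ->|j _];
    congr (_, _, _, _); rewrite /= ?addr0 ?scaler0 ?mulr0.
rewrite s1 s2; case: e => [[[a x] y] z] /=; congr (_, _, _, _).
- by rewrite /= /GRing.scale /= mulr1 mulr0 !addr0.
- by rewrite /= !scaler0 addr0 add0r addr0.
- by rewrite /= !scaler0 !add0r addr0.
- by rewrite /= /GRing.scale /= mulr0 mulr1 !add0r.
Qed.

(** The spatial partial derivatives are continuous, periodic and zero far out in [x] and [y], hence
    bounded by [periodic_bounded]. Their bounds add up to a Lipschitz constant, by the mean value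
    inequality along segments of the cover. *)
Lemma smooth_family_bounds (V : normedModType R) (X : R -> mfd -> V) :
  ode_space V -> smooth_family X -> compactly_supported X ->
  exists L M : R, [/\ 0 < L,
    forall t u v, 0 <= t <= 1 -> `|X t (proj u) - X t (proj v)| <= L * `|u - v| &
    forall t p, 0 <= t <= 1 -> `|X t p| <= M].
Proof.
move=> oV sX [K cK X0].
have [r r0 hK] := mfd_compact_bounded cK.
pose G (tu : R * coords) : V := X tu.1 (proj tu.2).
have [dG cDG] := sX 1%N; have cG := sX 0%N.
rewrite -/G in dG cDG; rewrite /class_C -/G in cG.
have G0 t u : ~ (`|u.1.1.2| <= r /\ `|u.1.2| <= r) -> G (t, u) = 0.
  by move=> h; apply: X0 => /hK.
have [M _ hM] : exists2 B : R, 0 <= B & forall t u, 0 <= t <= 1 -> `|G (t, u)| <= B.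
  by apply: (@periodic_bounded R n V G r cG) => // t u v; rewrite /G /= => ->.
have DB (b : coords) : exists B : R, 0 <= B /\
    forall t u, 0 <= t <= 1 -> `|'D_((0, b) : R * coords) G (t, u)| <= B.
  have [||B B0 hB] := @periodic_bounded R n V ('D_((0, b) : R * coords) G) r (cDG _).
  - move=> t u v uv; have -> : (t, u) = (t, v) + (0, u - v) :> R * coords.
      by congr (_, _); rewrite /= ?addr0// addrC subrK.
    rewrite derive_translate.
    suff -> : (fun y => G (y + (0, u - v))) = G by [].
    by apply/funext => -[s w]; rewrite /G /= addr0 mfd_proj_translate.
  - move=> t u h; rewrite -(derive_cst (0 : V) (t, u) (0, b)); apply/esym.
    apply: near_eq_derive.
    (* The complement of the closed cylinder is open, so [G] vanishes near the point and its
       derivative vanishes there. *)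
    suff [d d0 hd] : exists2 d : R, 0 < d & forall v : coords, `|u - v| < d ->
        ~ (`|v.1.1.2| <= r /\ `|v.1.2| <= r).
      apply: filterS (nbhsx_ballx (t, u) d d0) => -[s v].
      rewrite -ball_normE /= => hv; rewrite /cst G0//; apply: hd.
      apply: le_lt_trans hv.
      by have /pair_norm_le[] := lexx `|((t, u) : R * coords) - (s, v)|.
    have h2 : Num.max `|u.1.1.2| `|u.1.2| > r.
      by rewrite ltNge ge_max; apply/negP => /andP.
    exists (Num.max `|u.1.1.2| `|u.1.2| - r); first by rewrite subr_gt0.
    move=> v uv [v1 v2].
    have /pair_norm_le[/pair_norm_le[/pair_norm_le[_ n1] n2] _] := lexx `|u - v|.
    have m1 := ler_distD v.1.1.2 u.1.1.2 0; rewrite !subr0 in m1.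
    have m2 := ler_distD v.1.2 u.1.2 0; rewrite !subr0 in m2.
    move: uv; rewrite ltrBrDr lt_max; move: n1 n2 m1 m2 => /=.
    by move=> n1 n2 m1 m2 /orP[]; lra.
  - by exists B.
have [B1 [B10 hB1]] := DB (1, 0, 0, 0).
have [B4 [B40 hB4]] := DB (0, 0, 0, 1).
have /choice[B2 hB2] := fun j => DB (0, delta_mx 0 j, 0, 0).
have /choice[B3 hB3] := fun j => DB (0, 0, delta_mx 0 j, 0).
pose L := B1 + \sum_j B2 j + \sum_j B3 j + B4.
have DL t u (e : coords) : 0 <= t <= 1 ->
    `|'D_((0, e) : R * coords) G (t, u)| <= L * `|e|.
  move=> t01; rewrite deriveE//.
  (* Time is frozen: [i] embeds the spatial directions, and the derivative is expanded linearly over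
     a basis of them. *)
  pose i (b : coords) : R * coords := (0, b).
  have iD b c : i (b + c) = i b + i c by rewrite /i; congr (_, _); rewrite /= addr0.
  have iZ a b : i (a *: b) = a *: i b by rewrite /i; congr (_, _); rewrite /= scaler0.
  have iS (I : finType) (f : I -> coords) : i (\sum_j f j) = \sum_j i (f j).
    by apply: (big_morph i iD).
  have [e1 e2 e3 e4] := (coords_norm_le e (normr_ge0 e)).1 (lexx _).
  rewrite -/(i e) [in leLHS](coords_decomp e) !iD !iS !iZ !linearD !linear_sum /=.
  have bd (a B : R) (b : coords) : 0 <= B -> `|a| <= `|e| ->
      `|'D_(i b) G (t, u)| <= B -> `|'d G (t, u) (a *: i b)| <= B * `|e|.
    move=> B0 ae; rewrite deriveE// => h.
    by rewrite linearZ normrZ mulrC; exact: ler_pM.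
  rewrite !mulrDl !mulr_suml.
  apply: le_trans (ler_normD _ _) _; apply: lerD; last first.
    by rewrite -iZ iZ; apply: bd => //; exact: hB4.
  apply: le_trans (ler_normD _ _) _; apply: lerD; last first.
    apply: le_trans (ler_norm_sum _ _ _) _; apply: ler_sum => j _.
    by rewrite iZ; have [? h] := hB3 j; apply: bd => //; exact: h.
  apply: le_trans (ler_normD _ _) _; apply: lerD; last first.
    apply: le_trans (ler_norm_sum _ _ _) _; apply: ler_sum => j _.
    by rewrite iZ; have [? h] := hB2 j; apply: bd => //; exact: h.
  by apply: bd => //; exact: hB1.
have L0 : 0 <= L.
  rewrite /L !addr_ge0// sumr_ge0// => j _; by [case: (hB2 j) | case: (hB3 j)].
(* The added 1 keeps the constant positive even if all bounds are zero. *)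
exists (L + 1), M; split; first by rewrite ltr_wpDl.
- move=> t u v t01.
  have dl (s : R) : is_derive s 1 (fun s => G (s *: ((0, u - v) : R * coords) + (t, v)))
      ('D_((0, u - v) : R * coords) G (s *: ((0, u - v) : R * coords) + (t, v))).
    by apply: is_derive_line; apply: derivableP; exact: diff_derivable.
  have := @derive_bound_lipschitz R V oV _ _ (L * `|u - v|) 0 1 dl.
  rewrite !subr0 !normr1 mulr1 scale1r scale0r add0r => /(_ _)/wrap[].
    move=> tau _; rewrite (_ : _ + (t, v) = (t, tau *: (u - v) + v)).
      exact: DL.
    by congr (_, _); rewrite /= ?addr0 ?mulr1// scaler0 add0r.
  rewrite /G /= add0r subrK => h; apply: le_trans h _.
  by rewrite ler_wpM2r// lerDl.
- by move=> t p t01; have := hM t (mfd_lift p) t01; rewrite /G /= mfd_liftK.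
Qed.

End VectorFields.

(** * Flows and displacement cocycles *)

Lemma unif_continuous_continuous (U V : uniformType) (f : U -> V) :
  unif_continuous f -> continuous f.
Proof.
move=> uf x P /nbhsP[E entE EP]; apply/nbhsP; exists [set xy | E (f xy.1, f xy.2)].
  exact: uf.
move=> y /=; rewrite /xsection /= inE /= => Exy; apply: EP.
by rewrite /xsection /= inE.
Qed.

Section Flows.
Variables (R : realType) (n : nat).
Local Notation coords := (coords R n).
Local Notation mfd := (mfd R n).
Local Notation proj := (@mfd_proj R n).

Definition integral_curve (X : R -> mfd -> coords) (c : R -> coords) :=
  forall t : R, is_derive t 1 c (X t (proj (c t))).

Lemma integral_curve_shift (X : R -> mfd -> coords) (c : R -> coords) (a : coords) :
  (forall u, proj (u + a) = proj u) -> integral_curve X c ->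
  integral_curve X (fun t => c t + a).
Proof.
move=> pa cX t; rewrite pa.
by apply: is_derive_eq (is_deriveD (cX t) (is_derive_cst a t 1)) _; rewrite addr0.
Qed.

(** The Lipschitz hypothesis concerns only times between [0] and [t]; this suits time-dependent
    fields at [t = 1] and autonomous fields at every [t]. *)
Lemma integral_curve_gronwall (X : R -> mfd -> coords) (L t : R) (c c' : R -> coords) :
  0 <= L ->
  (forall tau u v, 0 <= tau <= 1 ->
    `|X (tau * t) (proj u) - X (tau * t) (proj v)| <= L * `|u - v|) ->
  integral_curve X c -> integral_curve X c' ->
  `|c t - c' t| <= 2 * `|c 0 - c' 0| * expR (2 * L * `|t|).
Proof.
move=> L0 XL cX c'X.
have dd (s : R) : is_derive s 1 (c - c') (X s (proj (c s)) - X s (proj (c' s))).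
  exact: is_deriveB.
apply: (gronwall (coords_ode_space R n) L0 dd) => tau tau01.
exact: XL.
Qed.

(** A flow comes with one lift of each orbit; a deck translation makes it start at the prescribed
    [u]. *)
Lemma flow_lift (X : R -> mfd -> coords) (phi : R -> mfd -> mfd) (u : coords) :
  is_flow X phi -> exists c : R -> coords,
    [/\ c 0 = u, integral_curve X c & forall t, proj (c t) = phi t (proj u)].
Proof.
move=> [phi0 hphi]; have [c pc dc] := hphi (proj u).
have c0 : proj u = proj (c 0) by rewrite pc phi0.
exists (fun t => c t + (u - c 0)); split.
- by rewrite addrC subrK.
- apply: integral_curve_shift => [w|t]; first exact: mfd_proj_translate.
  by rewrite pc; exact: dc.
- by move=> t; rewrite mfd_proj_translate.
Qed.

(* A lift to R of the theta-displacement of h, vanishing where |x| is large. *)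
Definition theta_cocycle (h : uhomeo mfd) (d : mfd -> R) : Prop :=
  [/\ continuous d, exists M, forall p, `|d p| <= M,
      exists r, forall p, r < `|p.1.1.2| -> d p = 0 /\ uhfun h p = p &
      forall u v, proj v = uhfun h (proj u) ->
        v.1.1.1 - u.1.1.1 - d (proj u) \is a Num.int].

(** [d] is the theta-displacement of lifted orbits over time 1. By uniqueness, orbits from two lifts
    of one point differ by a deck translation, so [d] lives on [mfd]. Gronwall makes it continuous,
    the bound on the speed makes it bounded, and orbits off the support of [X] stand still. *)
Lemma flow_theta_cocycle (X : R -> mfd -> coords) (phi : R -> mfd -> mfd)
    (h : uhomeo mfd) :
  smooth_family X -> compactly_supported X -> is_flow X phi -> uhfun h = phi 1 ->
  exists2 d, theta_cocycle h d & forall c, integral_curve X c ->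
    d (proj (c 0)) = (c 1 - c 0).1.1.1 /\ proj (c 1) = uhfun h (proj (c 0)).
Proof.
move=> sX cX fX hphi.
have [L [M [L0 XL XM]]] := smooth_family_bounds (coords_ode_space R n) sX cX.
have [K cK X0] := cX; have [r r0 hK] := mfd_compact_bounded cK.
have gron c c' : integral_curve X c -> integral_curve X c' ->
    `|c 1 - c' 1| <= 2 * `|c 0 - c' 0| * expR (2 * L).
  have XL1 (tau : R) u v : 0 <= tau <= 1 ->
      `|X (tau * 1) (proj u) - X (tau * 1) (proj v)| <= L * `|u - v|.
    by rewrite (mulr1 tau); exact: XL.
  move=> ic ic'; have := integral_curve_gronwall (ltW L0) XL1 ic ic'.
  by rewrite normr1 (mulr1 (2 * L)).
have uniq c c' : integral_curve X c -> integral_curve X c' -> c 0 = c' 0 -> c 1 = c' 1.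
  move=> ic ic' cc; have := gron _ _ ic ic'.
  by rewrite cc subrr normr0 mulr0 mul0r normr_le0 subr_eq0 => /eqP.
have /choice[P hP] := fun u => flow_lift u fX.
pose d p := (P (mfd_lift p) 1 - mfd_lift p).1.1.1.
have dE c : integral_curve X c -> d (proj (c 0)) = (c 1 - c 0).1.1.1.
  move=> ic; rewrite /d; set u := mfd_lift _; have [Pu0 icu pPu] := hP u.
  have pu : proj (c 0) = proj u by rewrite mfd_liftK.
  have -> : c 1 = P u 1 + (c 0 - u).
    apply: (uniq c (fun t => P u t + (c 0 - u))) => //.
      by apply: integral_curve_shift => // w; exact: mfd_proj_translate.
    by rewrite Pu0 addrC subrK.
  by congr (_.1.1.1); rewrite -addrA addrAC subrr sub0r.
have du u : d (proj u) = (P u 1 - u).1.1.1.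
  by have [Pu0 icu pPu] := hP u; rewrite -[in LHS]Pu0 dE// Pu0.
have pP u : proj (P u 1) = uhfun h (proj u) by have [_ _ ->] := hP u; rewrite hphi.
exists d; last first.
  move=> c ic; split; first exact: dE.
  by have [Pu0 icu _] := hP (c 0); rewrite -pP (uniq _ _ ic icu).
have fixd u : ~ K (proj u) -> P u 1 = u.
  move=> nK; have [Pu0 icu _] := hP u.
  apply: (uniq (P u) (cst u)) => // t; rewrite X0//; exact: is_derive_cst.
split.
- apply: mfd_continuousP.
  apply: (@lipschitz_continuous _ _ _ _ (2 * expR (2 * L) + 1)) => u v /=.
  have [Pu0 icu _] := hP u; have [Pv0 icv _] := hP v.
  have := gron _ _ icu icv; rewrite Pu0 Pv0 => g.
  have -> : d (proj u) - d (proj v) = ((P u 1 - P v 1) - (u - v)).1.1.1.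
    by rewrite !du /=; ring.
  have th (w : coords) : `|w.1.1.1| <= `|w|.
    by have /pair_norm_le[/pair_norm_le[/pair_norm_le[]]] := lexx `|w|.
  apply: le_trans (th _) _; apply: le_trans (ler_normB _ _) _.
  by rewrite mulrDl mul1r lerD2r -mulrA [expR _ * _]mulrC mulrA.
- exists M => p; rewrite -[p]mfd_liftK du; set u := mfd_lift p.
  have [Pu0 icu _] := hP u.
  have := @derive_bound_lipschitz R _ (coords_ode_space R n) (P u) _ M 0 1 icu.
  rewrite !subr0 normr1 mulr1 Pu0 => /(_ _)/wrap[].
    by move=> tau tau01; apply: XM; rewrite addr0 mulr1.
  by apply: le_trans; have /pair_norm_le[/pair_norm_le[/pair_norm_le[]]] := lexx `|P u 1 - u|.
- exists r => p rp.
  have nK : ~ K (proj (mfd_lift p)).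
    by rewrite mfd_liftK => /hK[]; rewrite leNgt rp.
  rewrite -[p]mfd_liftK du -pP fixd// subrr; split => //.
- move=> u v; rewrite -pP du => /mfd_proj_eqP[h1 _ _ _] /=.
  by rewrite (_ : _ - _ = v.1.1.1 - (P u 1).1.1.1)//; ring.
Qed.

Lemma Hamc_theta_cocycle (h : uhomeo mfd) : Hamc R n h -> exists d, theta_cocycle h d.
Proof.
move=> [X [H [phi [sX cX _ _ [fX hphi]]]]].
by have [d ? _] := flow_theta_cocycle sX cX fX hphi; exists d.
Qed.

(** Displacements add up under composition. Together with [theta_cocycle_inv] this equips conjugates
    with a cocycle by algebra alone. *)
Lemma theta_cocycle_mul (g h : uhomeo mfd) (dg dh : mfd -> R) :
  theta_cocycle g dg -> theta_cocycle h dh ->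
  theta_cocycle (g * h)%g (fun p => dh p + dg (uhfun h p)).
Proof.
move=> [cg [Mg hMg] [rg hrg] ig] [ch [Mh hMh] [rh hrh] ih].
have chh : continuous (uhfun h).
  by apply: unif_continuous_continuous; exact: uhfun_continuous.
split.
- move=> p; have cgh : dg (uhfun h q) @[q --> p] --> dg (uhfun h p).
    exact: (cvg_comp _ _ (chh p) (cg _)).
  exact: (cvgD (ch p) cgh).
- by exists (Mh + Mg) => p; apply: le_trans (ler_normD _ _) _; exact: lerD.
- exists (Num.max rg rh) => p; rewrite gt_max => /andP[/hrg[g1 g2] /hrh[h1 h2]].
  by rewrite h2 h1 g1 addr0; split => //=; rewrite h2.
- move=> u v /= e; set w := mfd_lift (uhfun h (proj u)).
  have pw : proj w = uhfun h (proj u) by rewrite mfd_liftK.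
  have -> : v.1.1.1 - u.1.1.1 - (dh (proj u) + dg (uhfun h (proj u))) =
      (v.1.1.1 - w.1.1.1 - dg (proj w)) + (w.1.1.1 - u.1.1.1 - dh (proj u)).
    by rewrite pw; ring.
  by apply: rpredD; [apply: ig; rewrite pw | exact: ih].
Qed.

Lemma theta_cocycle_inv (h : uhomeo mfd) (d : mfd -> R) :
  theta_cocycle h d -> theta_cocycle (h^-1)%g (fun p => - d (uhinv h p)).
Proof.
move=> [ch [M hM] [r hr] ih].
have chh : continuous (uhinv h).
  by apply: unif_continuous_continuous; exact: uhinv_continuous.
split.
- move=> p; have chp : d (uhinv h q) @[q --> p] --> d (uhinv h p).
    exact: (cvg_comp _ _ (chh p) (ch _)).
  exact: (cvgN chp).
- by exists M => p; rewrite normrN.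
- exists r => p /hr[h1 h2].
  have h3 : uhinv h p = p by rewrite -{1}h2 uhfunK.
  by rewrite h3 h1 oppr0.
- move=> u v /= e; rewrite -e opprK.
  have -> : v.1.1.1 - u.1.1.1 + d (proj v) = - (u.1.1.1 - v.1.1.1 - d (proj v)).
    by ring.
  by rewrite rpredN; apply: ih; rewrite e uhinvK.
Qed.

End Flows.

(** * Smooth functions *)

Lemma is_derive_affine (R : realType) (U V : normedModType R) (f : U -> V) x v df :
  (forall h : R, f (h *: v + x) - f x = h *: df) -> is_derive x v f df.
Proof.
move=> fE; apply/is_derive_cvg; under eq_fun do rewrite fE.
have : (cst df : R -> V) h @[h --> 0^'] --> df by exact: cvg_cst.
apply: cvg_trans; apply: near_eq_cvg; near=> h.
by rewrite /cst scalerA mulVf ?scale1r//; near: h; exact: nbhs_dnbhs_neq.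
Unshelve. all: by end_near. Qed.

Lemma derive_val_comp (R : realType) (U : normedModType R) (phi : R -> R) (f : U -> R)
  (x v : U) (d : R) :
  differentiable f x -> is_derive (f x) 1 phi d ->
  differentiable (phi \o f) x /\ 'D_v (phi \o f) x = d * 'D_v f x.
Proof.
move=> df [dphi <-]; have dphi' : differentiable phi (f x) by apply/derivable1_diffP.
have dc : differentiable (phi \o f) x by exact: differentiable_comp.
split => //; rewrite !deriveE// diff_comp//= -[in LHS](mulr1 ('d f x v)).
by rewrite -[_ * 1]/(_ *: 1) linearZ /= mulrC.
Qed.

Section ClassC.
Variables (R : realType) (U V : normedModType R).

Lemma class_C_pred k (f : U -> V) : class_C k.+1 f -> class_C k f.
Proof.
elim: k f => [|k IH] f [df cf]; first by move=> x; exact: differentiable_continuous.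
by split => // v; apply: IH; exact: cf.
Qed.

Lemma class_C_cst k (a : V) : class_C k (fun _ : U => a).
Proof.
elim: k a => [|k IH] a /=; first by move=> x; exact: cvg_cst.
split=> [x|v]; first exact: differentiable_cst.
have -> : (fun x => 'D_v (fun _ : U => a) x) = fun=> 0; last exact: IH.
by apply/funext => x; exact: (derive_cst a x v).
Qed.

Lemma class_C_add k (f g : U -> V) :
  class_C k f -> class_C k g -> class_C k (fun x => f x + g x).
Proof.
elim: k f g => [|k IH] f g /=; first by move=> cf cg x; exact: (cvgD (cf x) (cg x)).
move=> [df cf] [dg cg]; split=> [x|v]; first exact: (differentiableD (df x) (dg x)).
have -> : (fun x => 'D_v (fun x => f x + g x) x) = fun x => 'D_v f x + 'D_v g x;
  last by apply: IH.
by apply/funext => x; rewrite (@deriveD _ _ _ f g)//; exact: diff_derivable.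
Qed.

Lemma class_C_scalel k (f : U -> R) (e : V) :
  class_C k f -> class_C k (fun x => f x *: e).
Proof.
elim: k f => [|k IH] f /=.
  by move=> cf x; apply: cvgZr_tmp (cf x).
move=> [df cf]; split=> [x|v]; first exact: differentiableZl.
have -> : (fun x => 'D_v (fun x => f x *: e) x) = fun x => 'D_v f x *: e;
  last by apply: IH.
apply/funext => x; rewrite !deriveE//; last exact: differentiableZl.
by rewrite diffZl.
Qed.

Lemma class_C_sum k (I : Type) (r : seq I) (f : I -> U -> V) :
  (forall i, class_C k (f i)) -> class_C k (fun x => \sum_(i <- r) f i x).
Proof.
move=> cf; elim: r => [|i r IH].
  by under eq_fun do rewrite big_nil; exact: class_C_cst.
by under eq_fun do rewrite big_cons; exact: class_C_add.
Qed.

End ClassC.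

Section ClassCReal.
Variables (R : realType) (U : normedModType R).

Lemma class_C_linear k (l : U -> R) : linear l -> continuous l -> class_C k l.
Proof.
move=> ll cl; case: k => [//|k].
pose W : normedModType R := R.
pose L : {linear U -> W} := HB.pack l (GRing.isLinear.Build R U W *:%R l ll).
split=> [x|v]; first exact: (@linear_differentiable _ U W L x cl).
have -> : (fun x => 'D_v l x) = fun=> l v; last exact: class_C_cst.
apply/funext => x; suff [_ ->] : is_derive x v l (l v) by [].
by apply: is_derive_affine => h; rewrite ll addrK.
Qed.

Lemma class_C_mul k (f g : U -> R) :
  class_C k f -> class_C k g -> class_C k (fun x => f x * g x).
Proof.
elim: k f g => [|k IH] f g /=; first by move=> cf cg x; exact: (cvgM (cf x) (cg x)).
move=> [df cf] [dg cg]; split=> [x|v]; first exact: (differentiableM (df x) (dg x)).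
have -> : (fun x => 'D_v (fun x => f x * g x) x) =
    fun x => f x * 'D_v g x + g x * 'D_v f x; last first.
  by apply: class_C_add; apply: IH => //; apply: class_C_pred; split.
apply/funext => x; rewrite (@deriveM _ _ f g)//; exact: diff_derivable.
Qed.

(* Composition with a family of functions of one variable whose linear span is
   stable under differentiation. *)
Lemma class_C_comp (I : Type) (phi : I -> R -> R) (a b : I -> R) (s t : I -> I) :
  (forall i (x : R), is_derive x 1 (phi i) (a i * phi (s i) x + b i * phi (t i) x)) ->
  forall k i (f : U -> R), class_C k f -> class_C k (fun x => phi i (f x)).
Proof.
move=> dphi; elim=> [|k IH] i f cf.
  have cphi : continuous (phi i) by apply: is_derive_id_continuous (dphi i).
  by move=> x; exact: (cvg_comp _ _ (cf x) (cphi _)).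
have [df cDf] := cf; split=> [x|v].
  by have [] := derive_val_comp 0 (df x) (dphi i (f x)).
have -> : (fun x => 'D_v (fun x => phi i (f x)) x) =
    fun x => (a i * phi (s i) (f x) + b i * phi (t i) (f x)) * 'D_v f x; last first.
  apply: class_C_mul; last exact: cDf.
  apply: class_C_add; apply: class_C_mul;
    by [exact: class_C_cst | apply: IH; exact: class_C_pred].
by apply/funext => x; have [_] := derive_val_comp v (df x) (dphi i (f x)).
Qed.

End ClassCReal.

(** * The flat function [exp (- 1 / x)] and its derivatives *)

Section FlatFunction.
Variable R : realType.

(** The powers of [1 / x] make the span of the family stable under differentiation, as
    [class_C_comp] requires; [flat 0] is the function used for cutting off. *)
Definition flat k (x : R) : R := if 0 < x then x^-1 ^+ k * expR (- x^-1) else 0.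

Lemma flat_le0 k x : x <= 0 -> flat k x = 0.
Proof. by rewrite /flat ltNge => ->. Qed.

Lemma flat_ge0 k x : 0 <= flat k x.
Proof.
rewrite /flat; case: ifP => // x0.
by rewrite mulr_ge0 ?expR_ge0// exprn_ge0// invr_ge0 ltW.
Qed.

Lemma flat_gt0 k x : 0 < x -> 0 < flat k x.
Proof. by move=> x0; rewrite /flat x0 mulr_gt0 ?expR_gt0// exprn_gt0// invr_gt0. Qed.

(** With [y = 1 / x], this is the estimate of [exp y] from below by [y ^ (k + 1) / (k + 1)!]. *)
Lemma flat_bound k (x : R) : `|flat k x| <= (k.+1)`!%:R * `|x|.
Proof.
rewrite ger0_norm ?flat_ge0// /flat; case: ifP => x0; last by rewrite mulr_ge0.
rewrite (gtr0_norm x0) expRN ler_pdivrMr ?expR_gt0//.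
set y := x^-1; have y0 : 0 < y by rewrite invr_gt0.
have := expR_ge1Dxn k (ltW y0); set F := _`!%:R => h.
have F0 : 0 < F by rewrite ltr0n fact_gt0.
have -> : y ^+ k = F * x * (y ^+ k.+1 / F).
  by rewrite exprS /y; field; rewrite ?gt_eqF//= ?gt_eqF.
by rewrite ler_wpM2l ?mulr_ge0 ?(ltW F0) ?(ltW x0)//; lra.
Qed.

Lemma is_derive_flat k (x : R) :
  is_derive x 1 (flat k) (flat k.+2 x - k%:R * flat k.+1 x).
Proof.
have [x0|x0|->] := ltgtP x 0.
- rewrite !flat_le0 ?(ltW x0)// mulr0 subr0.
  apply: (@near_eq_is_derive _ _ _ (cst 0)).
  have nx : 0 < - x by rewrite oppr_gt0.
  apply: filterS (nbhsx_ballx x (- x) nx) => y; rewrite -ball_normE /= => xy.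
  by rewrite flat_le0//; move: xy; rewrite ltr_norml => /andP[]; lra.
- have nf : \near x, ((fun y : R => y^-1) ^+ k * (fun y => expR (- y^-1)) : R -> R) x = flat k x.
    apply: filterS (nbhsx_ballx x x x0) => y; rewrite -ball_normE /= => xy.
    rewrite /flat ifT; first by rewrite fctE /= exprfctE.
    by move: xy; rewrite ltr_norml => /andP[]; lra.
  have dV : is_derive x 1 (fun y : R => y^-1) (- x^-1 ^+ 2).
    have xn : x != 0 by rewrite gt_eqF.
    apply: DeriveDef; first exact: derivableV.
    by rewrite (@deriveV _ _ id)// derive_id /GRing.scale /= mulr1 exprVn.
  have dN : is_derive x 1 (fun y : R => - y^-1) (x^-1 ^+ 2).
    by rewrite -[X in is_derive _ _ _ X]opprK; exact: is_deriveN dV.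
  have dE : is_derive x 1 (fun y : R => expR (- y^-1)) (expR (- x^-1) * x^-1 ^+ 2).
    exact: (is_derive1_comp (is_derive_expR _) dN).
  have dX := is_deriveX k dV.
  apply: (near_eq_is_derive nf); apply: (is_derive_eq (is_deriveM dX dE)).
  rewrite /flat x0 /GRing.scale /=; case: k {dX nf} => [|k] /=.
    by rewrite exprfctE !expr0; ring.
  by rewrite exprfctE !exprS; ring.
(* At [0] the difference quotient of [flat k] is [flat k.+1], which tends to [0] by [flat_bound]. *)
- rewrite !flat_le0// mulr0 subr0; apply/is_derive_cvg.
  apply/cvgr0Pnorm_le => e e0.
  pose F : R := (k.+2)`!%:R; have F0 : 0 < F by rewrite ltr0n fact_gt0.
  have : \forall h \near (0:R)^', `|h| < e / F.
    by apply: dnbhs0_lt; rewrite divr_gt0.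
  apply: filterS => h; rewrite ltr_pdivlMr// => he.
  rewrite addr0 (flat_le0 k (lexx 0)) subr0 /GRing.scale /= mulr1.
  have -> : h^-1 * flat k h = flat k.+1 h.
    by rewrite /flat; case: ifP => _; rewrite ?mulr0// exprS mulrA.
  by apply: le_trans (flat_bound _ _) _; rewrite mulrC ltW.
Qed.

Lemma flat0_homo : {homo flat 0 : x y / x <= y}.
Proof.
move=> x y xy; have [x0|x0] := leP x 0; first by rewrite (flat_le0 _ x0) flat_ge0.
have y0 := lt_le_trans x0 xy.
rewrite /flat x0 y0 !expr0 !mul1r ler_expR lerN2 lef_pV2// posrE.
Qed.

End FlatFunction.

(** * The form [omega] and the flows of autonomous vector fields *)

Section Hamiltonian.
Variables (R : realType) (n : nat).
Local Notation coords := (coords R n).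
Local Notation mfd := (mfd R n).
Local Notation proj := (@mfd_proj R n).

(** For a fixed vector, [alpha0] is affine in the base point, so its difference quotients are
    constant. *)
Lemma mderive_alpha0 (p : mfd) (u v : coords) :
  mderive (fun q : mfd => alpha0 q v) p u =
  \sum_j (u.1.1.2 0 j * v.1.2 0 j - u.1.2 0 j * v.1.1.2 0 j) / 2.
Proof.
rewrite /mderive; suff [_ ->] : is_derive (mfd_lift p) u ((fun q : mfd => alpha0 q v) \o proj)
  (\sum_j (u.1.1.2 0 j * v.1.2 0 j - u.1.2 0 j * v.1.1.2 0 j) / 2) by [].
apply: is_derive_affine => h; rewrite /= /alpha0 /=.
rewrite opprD addrACA subrr addr0 -sumrB /GRing.scale /= mulr_sumr.
by apply: eq_bigr => j _; rewrite !mxE; ring.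
Qed.

(** This is the sum of the [dx_j dy_j] plus [dtheta] wedge [alpha0]; the two halves in [alpha0]
    combine under the exterior derivative. *)
Lemma omegaE (p : mfd) (u v : coords) :
  omega p u v = \sum_j (u.1.1.2 0 j * v.1.2 0 j - u.1.2 0 j * v.1.1.2 0 j)
    + u.1.1.1 * alpha0 p v - v.1.1.1 * alpha0 p u.
Proof.
rewrite /omega /lee_d1 /ext_d1 /wedge_form /lee_form /dtheta !mderive_alpha0.
rewrite -sumrB.
have -> : \sum_i ((u.1.1.2 0 i * v.1.2 0 i - u.1.2 0 i * v.1.1.2 0 i) / 2 -
    (v.1.1.2 0 i * u.1.2 0 i - v.1.2 0 i * u.1.1.2 0 i) / 2) =
  \sum_j (u.1.1.2 0 j * v.1.2 0 j - u.1.2 0 j * v.1.1.2 0 j).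
  by apply: eq_bigr => j _; field.
by ring.
Qed.

Lemma Hamc_one : Hamc R n (1%g : uhomeo mfd).
Proof.
exists (fun _ _ => 0), (fun _ _ => 0), (fun _ p => p); split.
- by move=> k; exact: class_C_cst.
- by exists set0 => //; exact: compact0.
- by move=> k; exact: class_C_cst.
- move=> t p v; rewrite /lee_d0 /ext_d0 /mderive mul0r subr0.
  rewrite (_ : _ \o _ = cst 0)// derive_cst oppr0 omegaE.
  rewrite big1 => [|j _]; last by rewrite !mxE; ring.
  have -> : alpha0 p 0 = 0.
    by rewrite /alpha0 big1 ?subrr// => j _; rewrite !mxE; ring.
  by rewrite /=; ring.
- split=> //; split=> // p; exists (fun=> mfd_lift p) => t; first exact: mfd_liftK.
  exact: is_derive_cst.
Qed.

(** Picard gives complete orbits on the cover, and Gronwall their uniqueness. Uniqueness makes the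
    flow descend to [mfd] and obey the group law, so time [-1] inverts time 1; Gronwall also gives
    uniform continuity. *)
Lemma autonomous_flow (X : mfd -> coords) :
  smooth_family (fun _ : R => X) -> compactly_supported (fun _ : R => X) ->
  exists phi (h : uhomeo mfd), is_flow (fun _ => X) phi /\ uhfun h = phi 1.
Proof.
move=> sX cX.
have [L [M [L0 XL XM]]] := smooth_family_bounds (coords_ode_space R n) sX cX.
have XL0 u v : `|X (proj u) - X (proj v)| <= L * `|u - v|.
  by apply: (XL 0); rewrite lexx ler01.
have XM0 u : `|X (proj u)| <= M by apply: (XM 0); rewrite lexx ler01.
have hc0 : forall u, exists c : R -> coords,
    c 0 = u /\ integral_curve (fun _ => X) c.
  by move=> u; have [c c0 dc] := picard (coords_ode_space R n) L0 XL0 XM0 u; exists c.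
have /choice[c hc] := hc0.
have gron t d d' : integral_curve (fun _ => X) d -> integral_curve (fun _ => X) d' ->
    `|d t - d' t| <= 2 * `|d 0 - d' 0| * expR (2 * L * `|t|).
  by apply: integral_curve_gronwall => [|tau u v _]; [exact: ltW | exact: XL0].
pose phi (t : R) p := proj (c (mfd_lift p) t).
have phiE t d : integral_curve (fun _ => X) d -> phi t (proj (d 0)) = proj (d t).
  move=> id; rewrite /phi; set u := mfd_lift _; have [c0 ic] := hc u.
  have pu : proj (d 0) = proj u by rewrite mfd_liftK.
  have := @gron t d (fun s => c u s + (d 0 - u)) id.
  rewrite /= c0 (addrC u) subrK subrr normr0 mulr0 mul0r normr_le0 subr_eq0.
  move=> /(_ _)/wrap[|/eqP ->]; last by rewrite mfd_proj_translate.
  by apply: integral_curve_shift => // w; exact: mfd_proj_translate.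
have phiD t s p : phi t (phi s p) = phi (t + s) p.
  have [_ ic] := hc (mfd_lift p).
  have it : integral_curve (fun _ => X) (fun r => c (mfd_lift p) (r + s)).
    by move=> r; apply: is_derive_translate; exact: ic.
  by have := phiE t _ it; rewrite add0r.
have phi0 p : phi 0 p = p by rewrite /phi (hc _).1 mfd_liftK.
have phiU t : unif_continuous (phi t).
  move=> E entE; have : entourage_ ball E by rewrite entourage_ballE.
  move=> [e /= e0 eE].
  (* The product of the constant comparing the two norms and the Gronwall factor. *)
  pose C : R := (2 * n%:R + 2) * (2 * expR (2 * L * `|t|)).
  have C0 : 0 < C.
    by rewrite !mulr_gt0 ?expR_gt0//; have := ler0n R n; lra.
  have : entourage_ ball [set pq : mfd * mfd | E (phi t pq.1, phi t pq.2)];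
    last by rewrite entourage_ballE.
  exists (e / C) => /=; first exact: divr_gt0.
  move=> [p q] /= /mfd_ballE; rewrite -[p in mfd_dist p]mfd_liftK.
  move=> /mfd_dist_lift[v pv]; rewrite ltr_pdivlMr// => uv.
  apply: eE => /=; apply/mfd_ballE.
  have [c0 ic] := hc v; rewrite -pv -[v in phi t (proj v)]c0 phiE//.
  apply: le_lt_trans (mfd_dist_le_norm _ _) _; apply: le_lt_trans uv.
  have [d0 id] := hc (mfd_lift p).
  have := gron t _ _ ic id; rewrite c0 d0 => g.
  have N0 : 0 <= 2 * n%:R + 2 :> R by have := ler0n R n; lra.
  apply: le_trans (ler_wpM2l N0 g) _; rewrite le_eqVlt; apply/orP; left.
  by apply/eqP; rewrite /C; ring.
have phiK s : cancel (phi s) (phi (- s)).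
  by move=> p; rewrite phiD addNr phi0.
have phiNK s : cancel (phi (- s)) (phi s).
  by move=> p; rewrite phiD subrr phi0.
exists phi, (UHomeo (phiK 1) (phiNK 1) (@phiU 1) (@phiU (- 1))); split=> //.
split=> // p; exists (c (mfd_lift p)) => // t.
by have [_ ic] := hc (mfd_lift p); exact: ic.
Qed.

End Hamiltonian.

(** * The obstruction *)

Section Obstruction.
Variables (R : realType) (n : nat).
Hypothesis hn : (1 <= n)%N.
Local Notation coords := (coords R n).
Local Notation mfd := (mfd R n).
Local Notation proj := (@mfd_proj R n).

(* The difference d is continuous on the ray that leaves p along an x-axis, and
   vanishes at its end, so it cannot jump from one integer to another. *)
Lemma near_int_small (d : mfd -> R) (r e : R) (p : mfd) :
  continuous d -> (forall p : mfd, r < `|p.1.1.2| -> d p = 0) -> e <= 1 / 4 ->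
  (forall p, exists2 k, k \is a Num.int & `|d p - k| <= e) -> `|d p| <= e.
Proof.
move=> cd dr e4 dint; set u := mfd_lift p.
(* Here [n >= 1] enters: it provides an unbounded direction in which to leave the support. *)
pose b : coords := (0, delta_mx 0 (Ordinal hn), 0, 0).
pose f (s : R) := `|d (proj (s *: b + u))|.
have cl : continuous (fun s : R => s *: b + u).
  apply: (@lipschitz_continuous _ _ _ _ `|b|) => s t.
  by rewrite opprD addrACA subrr addr0 -scalerBl normrZ mulrC.
have cf : continuous f.
  move=> s; apply: (cvg_norm (V := R)).
  have cp := cvg_comp _ _ (cl s) (@mfd_proj_continuous R n (s *: b + u)).
  exact: (cvg_comp _ _ cp (cd _)).
have e0 : 0 <= e by have [k _] := dint p; exact: le_trans.
(* A nonzero integer has absolute value at least 1, so [f] skips the values strictly between [e] and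
   [1 - e], among them [1 / 2] because [e <= 1 / 4]. *)
have gap s : f s <= e \/ 1 - e <= f s.
  have [k ki hk] := dint (proj (s *: b + u)); rewrite /f; set a := d _ in hk *.
  have [k0|k0] := eqVneq k 0; first by left; rewrite -[a]subr0 -k0.
  by right; have := norm_intr_ge1 ki k0; have := ler_normB a (a - k); rewrite subKr; lra.
(* Long enough that the [x]-part has norm above [r] wherever the ray starts. *)
pose T := `|r| + `|u.1.1.2| + 1.
have fT : f T = 0.
  rewrite /f dr ?normr0//= /T; have := ler_normD (T *: b + u).1.1.2 (- u.1.1.2).
  rewrite normrN /= addrK => h.
  have h2 : `|T| <= `|T *: (delta_mx 0 (Ordinal hn) : 'rV[R]_n)|.
    have := (rV_norm_le (T *: delta_mx 0 (Ordinal hn)) (normr_ge0 _)).1 (lexx _) (Ordinal hn).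
    by rewrite !mxE !eqxx mulr1.
  have h3 := ler_norm T; have h4 := ler_norm r.
  by have := le_trans h2 h; rewrite -/T; move: h3; rewrite {1}/T; lra.
have T0 : 0 <= T by rewrite !addr_ge0.
have f0 : f 0 = `|d p| by rewrite /f scale0r add0r mfd_liftK.
case: (gap 0) => [|h]; first by rewrite f0.
have [||c _ fc] := @IVT R f 0 T (1 / 2) T0.
- exact: continuous_subspaceT.
- by rewrite fT ge_min le_max; apply/andP; split; apply/orP; [right|left]; lra.
by case: (gap c); rewrite fc => ?; exfalso; lra.
Qed.

(** Nearby images have nearby lifts, so the two displacements differ by an integer up to [e];
    [near_int_small] shows that the integer is [0]. *)
Lemma close_cocycles (f g : uhomeo mfd) (df dg : mfd -> R) (e : R) :
  theta_cocycle f df -> theta_cocycle g dg -> e <= 1 / 4 ->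
  (forall p, mfd_dist (uhfun f p) (uhfun g p) < e) ->
  forall p, `|dg p - df p| <= e.
Proof.
move=> [cf _ [rf hrf] intf] [cg _ [rg hrg] intg] e4 fg p.
apply: (@near_int_small (fun p => dg p - df p) (Num.max rf rg)) => //.
- by move=> q; exact: (cvgB (cg q) (cf q)).
- by move=> q; rewrite gt_max => /andP[/hrf[-> _] /hrg[-> _]]; rewrite subrr.
- move=> q; set u := mfd_lift q; set v := mfd_lift (uhfun f q).
  have qu : proj u = q by rewrite mfd_liftK.
  have qv : proj v = uhfun f q by rewrite mfd_liftK.
  have := fg q; rewrite -qv => /mfd_dist_lift[w qw vw].
  exists (v.1.1.1 - u.1.1.1 - df q - (w.1.1.1 - u.1.1.1 - dg q)).
    by apply: rpredB; rewrite -qu; [apply: intf | apply: intg]; rewrite qu.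
  have -> : dg q - df q - (v.1.1.1 - u.1.1.1 - df q - (w.1.1.1 - u.1.1.1 - dg q)) =
      (w - v).1.1.1 by rewrite /=; ring.
  apply: le_trans (ltW vw).
  by have /pair_norm_le[/pair_norm_le[/pair_norm_le[]]] := lexx `|w - v|.
Qed.

(** Along an orbit of the conjugate its cocycle is [dg] plus the coboundary of [dh], and the
    coboundary telescopes. *)
Lemma conj_theta_cocycle (g h : uhomeo mfd) (dg dh : mfd -> R) :
  theta_cocycle g dg -> theta_cocycle h dh ->
  exists2 dk, theta_cocycle (h * g * h^-1)%g dk & forall m q,
    \sum_(i < m) dk (iter i (uhfun (h * g * h^-1)%g) (uhfun h q)) =
    \sum_(i < m) dg (iter i (uhfun g) q) + dh (iter m (uhfun g) q) - dh q.
Proof.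
move=> hg hh.
have := theta_cocycle_mul (theta_cocycle_mul hh hg) (theta_cocycle_inv hh).
set dk := (X in theta_cocycle _ X) => hk; exists dk => //.
have it i q : iter i (uhfun (h * g * h^-1)%g) (uhfun h q) = uhfun h (iter i (uhfun g) q).
  by elim: i => [//|i IH]; rewrite !iterS IH /= uhfunK.
elim=> [|m IH] q; first by rewrite !big_ord0 /= add0r subrr.
by rewrite !big_ord_recr /= IH it /dk /= uhfunK; ring.
Qed.

Lemma uniform_nbhs_approx (S : set (uhomeo mfd)) (f : uhomeo mfd) (e : R) :
  0 < e -> closure S f ->
  exists2 g, S g & forall p, mfd_dist (uhfun f p) (uhfun g p) < e.
Proof.
move=> e0 /(_ [set g | forall p, mfd_dist (uhfun f p) (uhfun g p) < e])[].
  apply/uhomeo_nbhs; exists [set pq : mfd * mfd | ball pq.1 e pq.2].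
    exact: (@entourage_ball _ _ (PosNum e0)).
  by move=> g fg p; apply/mfd_ballE; exact: fg.
by move=> g [Sg fg]; exists g.
Qed.

(** [A] is invariant under every map [e0]-close to [f]. A conjugate of [g] close to [f] thus drifts
    along a whole orbit in [A], while a conjugate close to the identity hardly drifts at all; both
    drifts are those of [g] along the same orbit, up to bounded terms. *)
Lemma attractor_not_rokhlin (f : uhomeo mfd) (df : mfd -> R) (A : set mfd)
    (a : mfd) (c e0 : R) :
  Hamc R n f -> theta_cocycle f df -> A a -> 0 < c -> 0 < e0 ->
  (forall p, A p -> c <= df p) ->
  (forall p q, A p -> mfd_dist (uhfun f p) q < e0 -> A q) ->
  ~ rokhlin_property (Hamc R n).
Proof.
move=> Hf hf Aa c0 e00 Ac Af [g Hg dense].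
(* [e0] keeps orbits in [A], [1 / 4] is the threshold of [close_cocycles], and [c / 4] leaves a gap
   [c - 2 e >= c / 2] between the two growth rates. *)
pose e := Num.min e0 (Num.min (c / 4) (1 / 4)).
have e_gt0 : 0 < e by rewrite !lt_min; apply/and3P; split; lra.
have [ee0 ec e4] : [/\ e <= e0, e <= c / 4 & e <= 1 / 4].
  by split; rewrite !ge_min lexx ?orbT.
have [dg hg] := Hamc_theta_cocycle Hg.
have [_ [h1 Hh1 <-] g1] := uniform_nbhs_approx e_gt0 (dense _ (@Hamc_one R n)).
have [_ [h2 Hh2 <-] g2] := uniform_nbhs_approx e_gt0 (dense _ Hf).
have [d1 hd1] := Hamc_theta_cocycle Hh1.
have [d2 hd2] := Hamc_theta_cocycle Hh2.
have [k1 hk1 s1] := conj_theta_cocycle hg hd1.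
have [k2 hk2 s2] := conj_theta_cocycle hg hd2.
have h11 : theta_cocycle (1%g : uhomeo mfd) (fun=> 0).
  split.
  - by apply: mfd_continuousP => u; exact: cvg_cst.
  - by exists 0 => p; rewrite normr0.
  - by exists 0.
  - by move=> u v /mfd_proj_eqP[]; rewrite subr0.
have b1 := close_cocycles h11 hk1 e4 g1.
have b2 := close_cocycles hf hk2 e4 g2.
have [_ [M1 hM1] _ _] := hd1; have [_ [M2 hM2] _ _] := hd2.
(* Chosen so that [h2] sends the orbit of [q] under [g] to the orbit of [a] under the second
   conjugate. *)
set q := uhinv h2 a.
have Aq i : A (iter i (uhfun (h2 * g * h2^-1)%g) (uhfun h2 q)).
  elim: i => [|i IH]; first by rewrite /= uhinvK.
  by rewrite iterS; apply: Af IH _; apply: lt_le_trans (g2 _) ee0.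
have up m : `|\sum_(i < m) dg (iter i (uhfun g) q)| <= m%:R * e + 2 * M1.
  have -> : \sum_(i < m) dg (iter i (uhfun g) q) =
      \sum_(i < m) k1 (iter i (uhfun (h1 * g * h1^-1)%g) (uhfun h1 q))
      - (d1 (iter m (uhfun g) q) - d1 q) by rewrite s1; ring.
  apply: le_trans (ler_normB _ _) _; apply: lerD.
    apply: le_trans (ler_norm_sum _ _ _) _.
    rewrite mulr_natl -[in leRHS](card_ord m) -sumr_const; apply: ler_sum => i _.
    by have := b1 (iter i (uhfun (h1 * g * h1^-1)%g) (uhfun h1 q)); rewrite subr0.
  apply: le_trans (ler_normB _ _) _.
  by have := hM1 (iter m (uhfun g) q); have := hM1 q; lra.
have lo m : m%:R * (c - e) - 2 * M2 <= \sum_(i < m) dg (iter i (uhfun g) q).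
  have -> : \sum_(i < m) dg (iter i (uhfun g) q) =
      \sum_(i < m) k2 (iter i (uhfun (h2 * g * h2^-1)%g) (uhfun h2 q))
      - (d2 (iter m (uhfun g) q) - d2 q) by rewrite s2; ring.
  apply: lerB.
    rewrite mulr_natl -[in leLHS](card_ord m) -sumr_const; apply: ler_sum => i _.
    have := Ac _ (Aq i); have := b2 (iter i (uhfun (h2 * g * h2^-1)%g) (uhfun h2 q)).
    by rewrite ler_norml => /andP[]; lra.
  apply: le_trans (ler_norm _) _; apply: le_trans (ler_normB _ _) _.
  by have := hM2 (iter m (uhfun g) q); have := hM2 q; lra.
(* After [N] steps the gap [N c / 2] exceeds the bounded error [2 M1 + 2 M2]. *)
pose N := (Num.truncn ((2 * M1 + 2 * M2) / (c / 2))).+1.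
have : (2 * M1 + 2 * M2) / (c / 2) < N%:R by exact: truncnS_gt.
rewrite ltr_pdivrMr; last by lra.
have := le_trans (lo N) (le_trans (ler_norm _) (up N)).
have : N%:R * e <= N%:R * (c / 4) by rewrite ler_wpM2l.
by lra.
Qed.

End Obstruction.

(** * The attractor *)

Lemma trig_int_periodic (R : realType) (a b : R) : a - b \is a Num.int ->
  cos (2 * pi * a) = cos (2 * pi * b) /\ sin (2 * pi * a) = sin (2 * pi * b).
Proof.
have key (m : nat) (x : R) : cos (2 * pi * (x + m%:R)) = cos (2 * pi * x) /\
    sin (2 * pi * (x + m%:R)) = sin (2 * pi * x).
  have -> : 2 * pi * (x + m%:R) = 2 * pi * x + (pi *+ 2) *+ m.
    by rewrite -[(pi *+ 2) *+ m]mulr_natr -[pi *+ 2]mulr_natr; ring.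
  by rewrite (periodicn (@cosD2pi R)) (periodicn (@sinD2pi R)).
move=> /intrP[[m|m] abm].
  have -> : a = b + m%:R by rewrite -[m%:R]abm addrC subrK.
  exact: key.
have -> : b = a + m.+1%:R.
  have e : a - b = - m.+1%:R by rewrite abm NegzE mulrNz.
  by rewrite -[b](subKr a) e opprK.
by have [-> ->] := key m.+1 a.
Qed.

Lemma class_C_coords (R : realType) (U : normedModType R) n k (f : U -> coords R n) :
  class_C k (fun x => (f x).1.1.1) -> (forall j, class_C k (fun x => (f x).1.1.2 0 j)) ->
  (forall j, class_C k (fun x => (f x).1.2 0 j)) -> class_C k (fun x => (f x).2) ->
  class_C k f.
Proof.
move=> f1 f2 f3 f4; rewrite (funext (fun x => coords_decomp (f x)) : f = _).
apply: class_C_add; last exact: class_C_scalel.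
apply: class_C_add; last by apply: class_C_sum => j; exact: class_C_scalel.
apply: class_C_add; last by apply: class_C_sum => j; exact: class_C_scalel.
exact: class_C_scalel.
Qed.

(** If [f 1] were above [b - mu], then by monotonicity [f] would be so on all of [0, 1], hence would
    fall at rate at least [mu] throughout. *)
Lemma strict_decrease (R : realType) (f f' : R -> R) (b mu : R) :
  (forall t : R, is_derive t 1 f (f' t)) ->
  (forall t, 0 <= t <= 1 -> f' t <= 0) ->
  (forall t, 0 <= t <= 1 -> b - mu < f t -> f' t <= - mu) ->
  f 0 <= b -> f 1 <= b - mu.
Proof.
move=> df f'0 f'mu f0; have [//|f1] := leP; exfalso.
have cf s t : {within `[s, t], continuous f}.
  by apply: is_derive1_continuous => r _; exact: df.
have mono t : 0 <= t <= 1 -> f 1 <= f t.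
  move=> /andP[t0 t1].
  have [c] := MVT_segment t1 (fun s _ => df s) (cf t 1).
  rewrite in_itv /= => /andP[tc c1] e; rewrite -subr_le0 e.
  by rewrite mulr_le0_ge0 ?subr_ge0// f'0// c1 (le_trans t0).
have [c] := MVT_segment ler01 (fun s _ => df s) (cf 0 1).
rewrite in_itv /= subr0 mulr1 => c01 e.
have := f'mu c c01 (lt_le_trans f1 (mono c c01)); lra.
Qed.

Section Attractor.
Variables (R : realType) (n : nat).
Local Notation coords := (coords R n).
Local Notation mfd := (mfd R n).
Local Notation proj := (@mfd_proj R n).

Definition radius2 (u : coords) : R :=
  \sum_j (u.1.1.2 0 j * u.1.1.2 0 j + u.1.2 0 j * u.1.2 0 j).

Definition cosz (u : coords) : R := cos (2 * pi * u.2).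
Definition sinz (u : coords) : R := sin (2 * pi * u.2).

(** The bump is [flat 0 (1 - radius2)], positive exactly where [radius2 < 1]. *)
Definition attractor_ham (u : coords) : R :=
  flat 0 (1 - radius2 u) * (sinz u / (2 * pi)).

(** The solution [X] of [iota_X omega = - d_eta H] for [H = attractor_ham]. Since [flat 2] is the
    derivative of [flat 0], the bump has derivative [- f2] with respect to [radius2]. *)
Definition attractor_field (u : coords) : coords :=
  let f0 := flat 0 (1 - radius2 u) in
  let f2 := flat 2 (1 - radius2 u) in
  let s := sinz u / (2 * pi) in
  (f0 * cosz u,
   \row_j (2 * u.1.2 0 j * f2 * s - u.1.1.2 0 j * f0 * cosz u / 2),
   \row_j (- (2 * u.1.1.2 0 j * f2 * s) - u.1.2 0 j * f0 * cosz u / 2),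
   - (radius2 u * f2 + f0) * s).

Lemma periodic_coords (u v : coords) : proj u = proj v ->
  [/\ u.1.1.2 = v.1.1.2, u.1.2 = v.1.2, radius2 u = radius2 v, cosz u = cosz v &
      sinz u = sinz v].
Proof.
move=> /mfd_proj_eqP[_ ex ey /trig_int_periodic[ec es]].
by rewrite /radius2 /cosz /sinz ex ey ec es.
Qed.

Lemma attractor_ham_periodic (u v : coords) :
  proj u = proj v -> attractor_ham u = attractor_ham v.
Proof. by move=> /periodic_coords[_ _ er _ es]; rewrite /attractor_ham er es. Qed.

Lemma attractor_field_periodic (u v : coords) :
  proj u = proj v -> attractor_field u = attractor_field v.
Proof.
by move=> /periodic_coords[ex ey er ec es]; rewrite /attractor_field ex ey er ec es.
Qed.

Lemma radius2_ge0 u : 0 <= radius2 u.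
Proof. by apply: sumr_ge0 => j _; rewrite addr_ge0// -expr2 sqr_ge0. Qed.

Lemma radius2_bound u (b : R) : 0 <= b -> radius2 u <= b ^+ 2 ->
  `|u.1.1.2| <= b /\ `|u.1.2| <= b.
Proof.
move=> b0 ub.
have h j : u.1.1.2 0 j ^+ 2 + u.1.2 0 j ^+ 2 <= b ^+ 2.
  apply: le_trans ub; rewrite /radius2 (bigD1 j)//= -!expr2 lerDl.
  by apply: sumr_ge0 => i _; rewrite addr_ge0// -expr2 sqr_ge0.
split; apply/(rV_norm_le _ b0) => j;
  rewrite -(ler_pXn2r (n := 2))// ?nnegrE// real_normK ?num_real//;
  have := h j; have := sqr_ge0 (u.1.1.2 0 j); have := sqr_ge0 (u.1.2 0 j); lra.
Qed.

(** * Smoothness of the Hamiltonian and of its vector field *)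

Section Smoothness.
Variables (U : normedModType R) (f : U -> coords).
Hypothesis lf : linear f.
Hypothesis cf : continuous f.

Let cx j k : class_C k (fun w => (f w).1.1.2 0 j).
Proof.
apply: class_C_linear; first by move=> a x y; rewrite lf /= !mxE.
move=> w; have h : continuous (fun u : coords => u.1.1.2 0 j).
  apply: (@lipschitz_continuous _ _ _ _ 1) => u v; rewrite mul1r.
  have [_ + _ _] := (coords_norm_le (u - v) (normr_ge0 _)).1 (lexx _).
  by move=> /(_ j); rewrite !mxE.
exact: (continuous_comp (@cf w) (h (f w))).
Qed.

Let cy j k : class_C k (fun w => (f w).1.2 0 j).
Proof.
apply: class_C_linear; first by move=> a x y; rewrite lf /= !mxE.
move=> w; have h : continuous (fun u : coords => u.1.2 0 j).
  apply: (@lipschitz_continuous _ _ _ _ 1) => u v; rewrite mul1r.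
  have [_ _ + _] := (coords_norm_le (u - v) (normr_ge0 _)).1 (lexx _).
  by move=> /(_ j); rewrite !mxE.
exact: (continuous_comp (@cf w) (h (f w))).
Qed.

Let cz k : class_C k (fun w => (f w).2).
Proof.
apply: class_C_linear; first by move=> a x y; rewrite lf.
move=> w; have h : continuous (fun u : coords => u.2).
  apply: (@lipschitz_continuous _ _ _ _ 1) => u v; rewrite mul1r.
  by have [_ _ _ +] := (coords_norm_le (u - v) (normr_ge0 _)).1 (lexx _).
exact: (continuous_comp (@cf w) (h (f w))).
Qed.

(** The linear map [f] will be either the identity of [coords] or the projection that forgets
    time. *)
Lemma class_C_1Bradius2 k : class_C k (fun w => 1 - radius2 (f w)).
Proof.
apply: class_C_add; first exact: class_C_cst.
rewrite (_ : (fun w => _) = fun w => (-1) * radius2 (f w)); last first.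
  by apply/funext => w; rewrite mulN1r.
apply: class_C_mul; first exact: class_C_cst.
by apply: class_C_sum => j; apply: class_C_add; apply: class_C_mul.
Qed.

Lemma class_C_radius2 k : class_C k (fun w => radius2 (f w)).
Proof. by apply: class_C_sum => j; apply: class_C_add; apply: class_C_mul. Qed.

Lemma class_C_flat i k : class_C k (fun w => flat i (1 - radius2 (f w))).
Proof.
apply: (@class_C_comp R U nat (@flat R) (fun=> 1) (fun i => - i%:R) (fun i => i.+2) S).
  by move=> j x; rewrite mul1r mulNr; exact: is_derive_flat.
exact: class_C_1Bradius2.
Qed.

(** Sine shifted by [i] quarter periods: differentiation raises the index, so [class_C_comp] treats
    sine and cosine together. *)
Let trig (i : nat) (x : R) := sin (x + i%:R * (pi / 2)).

Let is_derive_trig i (x : R) :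
  is_derive x 1 (trig i) (1 * trig i.+1 x + 0 * trig i x).
Proof.
have -> : 1 * trig i.+1 x + 0 * trig i x = cos (x + i%:R * (pi / 2)).
  rewrite mul1r mul0r addr0 /trig -sinDpihalf; congr (sin _).
  by rewrite -[i.+1%:R]natr1; ring.
exact: (is_derive_translate (is_derive_sin _)).
Qed.

Let c2piz k : class_C k (fun w => 2 * pi * (f w).2).
Proof. by apply: class_C_mul => //; exact: class_C_cst. Qed.

Lemma class_C_sinz k : class_C k (fun w => sinz (f w)).
Proof.
have := @class_C_comp R U nat trig _ _ _ _ is_derive_trig k 0%N _ (c2piz k).
by under eq_fun do rewrite /trig mul0r addr0.
Qed.

Lemma class_C_cosz k : class_C k (fun w => cosz (f w)).
Proof.
have := @class_C_comp R U nat trig _ _ _ _ is_derive_trig k 1%N _ (c2piz k).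
by under eq_fun do rewrite /trig mul1r sinDpihalf.
Qed.

Lemma class_C_attractor_ham k : class_C k (fun w => attractor_ham (f w)).
Proof.
apply: class_C_mul; first exact: class_C_flat.
by apply: class_C_mul; [exact: class_C_sinz | exact: class_C_cst].
Qed.

Lemma class_C_attractor_field k : class_C k (fun w => attractor_field (f w)).
Proof.
have cN (g : U -> R) : class_C k g -> class_C k (fun w => - g w).
  move=> cg; under eq_fun do rewrite -mulN1r.
  by apply: class_C_mul => //; exact: class_C_cst.
have cs : class_C k (fun w => sinz (f w) / (2 * pi)).
  by apply: class_C_mul; [exact: class_C_sinz | exact: class_C_cst].
have c1 (g : U -> R) : class_C k g ->
    class_C k (fun w => 2 * g w * flat 2 (1 - radius2 (f w)) * (sinz (f w) / (2 * pi))).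
  move=> cg; apply: class_C_mul => //; apply: class_C_mul; last exact: class_C_flat.
  by apply: class_C_mul => //; exact: class_C_cst.
have c2 (g : U -> R) : class_C k g ->
    class_C k (fun w => g w * flat 0 (1 - radius2 (f w)) * cosz (f w) / 2).
  move=> cg; apply: class_C_mul; last exact: class_C_cst.
  apply: class_C_mul; last exact: class_C_cosz.
  by apply: class_C_mul => //; exact: class_C_flat.
apply: class_C_coords => [|j|j|] /=.
- by apply: class_C_mul; [exact: class_C_flat | exact: class_C_cosz].
- under eq_fun do rewrite mxE.
  by apply: class_C_add; [exact: c1 | apply: cN; exact: c2].
- under eq_fun do rewrite mxE.
  by apply: class_C_add; apply: cN; [exact: c1 | exact: c2].
- apply: class_C_mul => //; apply: cN; apply: class_C_add; last exact: class_C_flat.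
  by apply: class_C_mul; [exact: class_C_radius2 | exact: class_C_flat].
Qed.

End Smoothness.

End Attractor.

(** * Verification that the vector field is Hamiltonian and compactly supported *)

Section AttractorDynamics.
Variables (R : realType) (n : nat).
Local Notation coords := (coords R n).
Local Notation mfd := (mfd R n).
Local Notation proj := (@mfd_proj R n).
Local Notation radius2 := (@radius2 R n).
Local Notation cosz := (@cosz R n).
Local Notation sinz := (@sinz R n).

Let id_linear : linear (@id coords).
Proof. by []. Qed.

Let id_continuous : continuous (@id coords).
Proof. by move=> u. Qed.

Lemma is_derive_radius2 (V : normedModType R) (c : V -> coords) (x v : V) (dc : coords) :
  is_derive x v c dc ->
  is_derive x v (fun s => radius2 (c s))
    (2 * \sum_j ((c x).1.1.2 0 j * dc.1.1.2 0 j + (c x).1.2 0 j * dc.1.2 0 j)).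
Proof.
move=> /is_derive_pair[/is_derive_pair[/is_derive_pair[_ /is_derive_rV dx]
  /is_derive_rV dy] _].
pose h (j : 'I_n) : V -> R := (fun s => (c s).1.1.2 0 j) * (fun s => (c s).1.1.2 0 j)
  + (fun s => (c s).1.2 0 j) * (fun s => (c s).1.2 0 j).
have dh j : is_derive x v (h j)
    (2 * ((c x).1.1.2 0 j * dc.1.1.2 0 j + (c x).1.2 0 j * dc.1.2 0 j)).
  apply: (is_derive_eq (is_deriveD (is_deriveM (dx j) (dx j)) (is_deriveM (dy j) (dy j)))).
  by rewrite /GRing.scale /=; ring.
have -> : (fun s => radius2 (c s)) = \sum_j h j.
  by apply/funext => s; rewrite fct_sumE.
by rewrite mulr_sumr; exact: is_derive_sum.
Qed.

Lemma derive_attractor_ham (u v : coords) :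
  'D_v (@attractor_ham R n) u =
  - flat 2 (1 - radius2 u)
    * (2 * \sum_j (u.1.1.2 0 j * v.1.1.2 0 j + u.1.2 0 j * v.1.2 0 j))
    * (sinz u / (2 * pi)) + flat 0 (1 - radius2 u) * cosz u * v.2.
Proof.
have dr : is_derive u v (fun w : coords => 1 - radius2 w)
    (- (2 * \sum_j (u.1.1.2 0 j * v.1.1.2 0 j + u.1.2 0 j * v.1.2 0 j))).
  have h := is_deriveB (is_derive_cst (1 : R) u v) (is_derive_radius2 (is_derive_id u v)).
  by apply: (is_derive_eq h); rewrite sub0r.
have [dif _] := @class_C_1Bradius2 R n coords id id_linear id_continuous 1%N.
have [d1 D1] := derive_val_comp v (dif u) (is_derive_flat 0 (1 - radius2 u)).
have dz : is_derive u v (fun w : coords => 2 * pi * w.2) (2 * pi * v.2).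
  by apply: is_derive_affine => h; rewrite /= /GRing.scale /=; ring.
have difl : differentiable (fun w : coords => 2 * pi * w.2) u.
  have [+ _] : class_C 1 (fun w : coords => 2 * pi * w.2); last by [].
  apply: class_C_mul; first exact: class_C_cst.
  apply: class_C_linear => [a x y //|]; apply: (@lipschitz_continuous _ _ _ _ 1) => x y.
  by rewrite mul1r; have /pair_norm_le[] := lexx `|x - y|.
have [d2 D2] := derive_val_comp v difl (is_derive_sin (2 * pi * u.2)).
have i1 := @derivableP _ _ _ _ u v (diff_derivable d1).
have i2 := @derivableP _ _ _ _ u v (diff_derivable d2).
have i3 := is_deriveM i1 (is_deriveM i2 (is_derive_cst (2 * pi)^-1 u v)).
have -> : @attractor_ham R n = (@flat R 0 \o (fun w : coords => 1 - radius2 w))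
  * ((@sin R \o (fun w : coords => 2 * pi * w.2)) * cst (2 * pi)^-1) by [].
have [_ ->] := i3; rewrite D1 D2 /GRing.scale /=.
have [_ ->] := dr; have [_ ->] := dz.
rewrite mul0r subr0 mulr0 add0r !fctE /= -/(sinz u) -/(cosz u).
by have := lt0r_neq0 (pi_gt0 R); move: (pi : R) => P P0; field.
Qed.

Lemma attractor_hamiltonian :
  hamiltonian (fun (_ : R) (p : mfd) => attractor_field (mfd_lift p))
    (fun (_ : R) (p : mfd) => attractor_ham (mfd_lift p)).
Proof.
move=> _ p v; rewrite omegaE /lee_d0 /ext_d0 /mderive /lee_form /dtheta.
set u := mfd_lift p.
have -> : (fun p : mfd => attractor_ham (mfd_lift p)) \o proj = @attractor_ham R n.
  by apply/funext => w /=; apply: attractor_ham_periodic; rewrite mfd_liftK.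
rewrite derive_attractor_ham -/u.
have [px py] : p.1.1.2 = u.1.1.2 /\ p.1.2 = u.1.2 by [].
set F2 := flat 2 _; set F0 := flat 0 _; set S := sinz u / _; set C := cosz u.
(* [alpha0 (X) = H]: the [radius2] terms cancel. The [dtheta] term of [omega] thereby becomes the
   Lee term of [d_eta H]. *)
have aX : alpha0 p (attractor_field u) = F0 * S.
  rewrite /alpha0 px py /= -/F0 -/F2 -/S -/C.
  have -> : \sum_j (u.1.1.2 0 j * (\row_k (- (2 * u.1.1.2 0 k * F2 * S)
      - u.1.2 0 k * F0 * C / 2) : 'rV[R]_n) 0 j
      - u.1.2 0 j * (\row_k (2 * u.1.2 0 k * F2 * S - u.1.1.2 0 k * F0 * C / 2)
        : 'rV[R]_n) 0 j) / 2 = - F2 * S * radius2 u.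
    rewrite /Defs.mfd /radius2 mulr_sumr; by apply: eq_bigr => j _; rewrite !mxE; field.
  by ring.
rewrite aX /alpha0 px py /= -/F0 -/F2 -/S -/C.
have -> : \sum_j ((\row_k (2 * u.1.2 0 k * F2 * S - u.1.1.2 0 k * F0 * C / 2)
        : 'rV[R]_n) 0 j * v.1.2 0 j -
      (\row_k (- (2 * u.1.1.2 0 k * F2 * S) - u.1.2 0 k * F0 * C / 2)
        : 'rV[R]_n) 0 j * v.1.1.2 0 j) =
    2 * F2 * S * (\sum_j (u.1.1.2 0 j * v.1.1.2 0 j + u.1.2 0 j * v.1.2 0 j))
    - F0 * C * \sum_j ((u.1.1.2 0 j * v.1.2 0 j - u.1.2 0 j * v.1.1.2 0 j) / 2).
  rewrite !mulr_sumr -sumrB; by apply: eq_bigr => j _; rewrite !mxE; field.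
by rewrite /attractor_ham -/F0 -/S; ring.
Qed.

Lemma attractor_field_smooth :
  smooth_family (fun (_ : R) (p : mfd) => attractor_field (mfd_lift p)).
Proof.
move=> k; rewrite (_ : (fun tu => _) = fun tu : (R * coords)%type => attractor_field tu.2).
  apply: class_C_attractor_field => //; move=> x; exact: cvg_snd.
by apply/funext => -[t u] /=; apply: attractor_field_periodic; rewrite mfd_liftK.
Qed.

Lemma attractor_ham_smooth :
  smooth_family (fun (_ : R) (p : mfd) => attractor_ham (mfd_lift p)).
Proof.
move=> k; rewrite (_ : (fun tu => _) = fun tu : (R * coords)%type => attractor_ham tu.2).
  apply: class_C_attractor_ham => //; move=> x; exact: cvg_snd.
by apply/funext => -[t u] /=; apply: attractor_ham_periodic; rewrite mfd_liftK.
Qed.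

Lemma attractor_field_supp :
  compactly_supported (fun (_ : R) (p : mfd) => attractor_field (mfd_lift p)).
Proof.
exists (proj @` @coord_box R n 1).
  apply: continuous_compact; last exact: coord_box_compact.
  apply: continuous_subspaceT; exact: mfd_proj_continuous.
move=> _ p nK; set u := mfd_lift p.
have r1 : 1 <= radius2 u.
  rewrite leNgt; apply/negP => r1; apply: nK.
  have [||h1 h2] := @radius2_bound R n u 1; [exact: ler01 | by rewrite expr1n ltW |].
  have [v bv pv] := coord_box_cover h1 h2; exists v => //.
  by rewrite pv mfd_liftK.
have fz k : flat k (1 - radius2 u) = 0 by apply: flat_le0; rewrite subr_le0.
rewrite /attractor_field !fz mul0r mulr0 addr0 oppr0 mul0r.
congr (_, _, _, _); apply/rowP => j; rewrite !mxE; ring.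
Qed.

End AttractorDynamics.

(** * The trapping region around the attracting circle *)

Section Trapping.
Variables (R : realType) (n : nat).
Local Notation coords := (coords R n).
Local Notation mfd := (mfd R n).
Local Notation proj := (@mfd_proj R n).
Local Notation radius2 := (@radius2 R n).
Local Notation cosz := (@cosz R n).
Local Notation sinz := (@sinz R n).
Local Notation a0 := (flat 0 (1 / 2 : R)).

Let a0_gt0 : 0 < a0. Proof. by apply: flat_gt0; lra. Qed.

Let a0_le1 : a0 <= 1.
Proof.
by rewrite /flat ifT ?expr0 ?mul1r ?expR_le1 ?oppr_le0 ?invr_ge0//; lra.
Qed.

(** Along the flow [cosz] grows at rate [sinz ^ 2 * b >= 0]; so it stays at least [1 / 2], and then
    [radius2] cannot grow either. By monotonicity of [flat 0] the bump stays at least [a0], which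
    makes the three estimates quantitative. *)
Lemma attractor_trap (c : R -> coords) :
  (forall t : R, is_derive t 1 c (attractor_field (c t))) ->
  1 / 2 <= cosz (c 0) -> radius2 (c 0) <= 1 / 2 ->
  [/\ 1 / 2 + a0 / 4 <= cosz (c 1), radius2 (c 1) <= 1 / 2 - a0 / 8 &
      a0 / 2 <= (c 1).1.1.1 - (c 0).1.1.1].
Proof.
move=> dc C0 S0.
pose r t := radius2 (c t).
pose b t := r t * flat 2 (1 - r t) + flat 0 (1 - r t).
have b_ge t : flat 0 (1 - r t) <= b t.
  by rewrite lerDr mulr_ge0 ?flat_ge0// radius2_ge0.
have b_ge0 t : 0 <= b t by apply: le_trans (b_ge t); exact: flat_ge0.
have dS (t : R) : is_derive t 1 r (- (r t * flat 0 (1 - r t) * cosz (c t))).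
  apply: (is_derive_eq (is_derive_radius2 (dc t))).
  rewrite /attractor_field /= -/(r t); set F0 := flat 0 _; set F2 := flat 2 _.
  rewrite /r /radius2 !mulr_suml mulr_sumr -sumrN.
  by apply: eq_bigr => j _; rewrite !mxE; move: (sinz _ / _) => S; field.
have dC (t : R) : is_derive t 1 (fun s => - cosz (c s)) (- (sinz (c t) ^+ 2 * b t)).
  have /is_derive_pair[_ dz] := dc t.
  have dz2 : is_derive t 1 (fun s => 2 * pi * (c s).2)
      (2 * pi * (attractor_field (c t)).2) := is_deriveZ (2 * pi) dz.
  have h := @is_derive1_comp R (@cos R) _ t _ _ (is_derive_cos _) dz2.
  apply: (is_derive_eq (is_deriveN h)); rewrite /= -/(sinz (c t)) /b /r /GRing.scale /=.
  by have := lt0r_neq0 (pi_gt0 R); move: (pi : R) => P P0; field.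
have cs t : sinz (c t) ^+ 2 = 1 - cosz (c t) ^+ 2 by exact: sin2cos2.
have Cmono t : 0 <= t -> cosz (c 0) <= cosz (c t).
  move=> t0; have [|s _] := MVT_segment t0 (fun s _ => dC s).
    by apply: is_derive1_continuous => s _; exact: dC.
  rewrite subr0 => e.
  have : 0 <= sinz (c s) ^+ 2 * b s * t.
    by rewrite mulr_ge0// mulr_ge0 ?sqr_ge0.
  by move: e; rewrite mulNr; lra.
have C1 t : cosz (c t) <= 1.
  by have := cos_max (2 * pi * (c t).2); rewrite ler_norml => /andP[].
have S_ge0 t : 0 <= r t := radius2_ge0 (c t).
have S'0 t : 0 <= t -> 0 <= r t * flat 0 (1 - r t) * cosz (c t).
  move=> t0; rewrite !mulr_ge0 ?flat_ge0//.
  by apply: le_trans (Cmono t t0); lra.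
have Smono t : 0 <= t -> r t <= 1 / 2.
  move=> t0; have [|s] := MVT_segment t0 (fun s _ => dS s).
    by apply: is_derive1_continuous => s _; exact: dS.
  rewrite in_itv /= subr0 => /andP[s0 _] e.
  by have := mulr_ge0 (S'0 s s0) t0; move: e S0; rewrite mulNr -/(r 0); lra.
have F0 t : 0 <= t -> a0 <= flat 0 (1 - r t).
  by move=> /Smono h; apply: flat0_homo; lra.
split.
(* As long as [cosz] is below [1 / 2 + a0 / 4 <= 3 / 4], its growth rate is at least [a0 / 4], as
   [sinz ^ 2 >= 1 / 4]. *)
- have := @strict_decrease R _ _ (- (1 / 2)) (a0 / 4) dC.
  move=> /(_ _ _ _)/wrap[]; last by lra.
  + by move=> t _; rewrite oppr_le0 mulr_ge0 ?sqr_ge0.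
  + move=> t /andP[t0 _] /= Ct; rewrite lerN2 cs.
    have Cl := Cmono t t0.
    have h1 : 1 / 4 <= 1 - cosz (c t) ^+ 2.
      have : cosz (c t) ^+ 2 <= (3 / 4) ^+ 2.
        by rewrite ler_pXn2r// ?nnegrE; have := a0_le1; lra.
      by rewrite expr2; lra.
    have h2 := le_trans (F0 t t0) (b_ge t).
    have -> : a0 / 4 = 1 / 4 * a0 by ring.
    by apply: ler_pM => //; exact: ltW.
  + by lra.
(* As long as [r] exceeds [1 / 2 - a0 / 8 >= 3 / 8], it falls at rate at least
   [3 a0 / 16 >= a0 / 8]. *)
- apply: (strict_decrease dS) => // t /andP[t0 _].
    by rewrite oppr_le0; exact: S'0.
  move=> St; rewrite lerN2.
  have h1 : 3 / 8 <= r t by move: St a0_le1 => /=; lra.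
  have h2 : 3 / 8 * a0 <= r t * flat 0 (1 - r t).
    by apply: ler_pM => //; [exact: ltW | exact: F0].
  have Cl := Cmono t t0.
  have : 3 / 8 * a0 * (1 / 2) <= r t * flat 0 (1 - r t) * cosz (c t).
    by apply: ler_pM => //; move: a0_gt0; lra.
  by move: a0_gt0; lra.
- have dth (t : R) : is_derive t 1 (fun s => (c s).1.1.1) (flat 0 (1 - r t) * cosz (c t)).
    by have /is_derive_pair[/is_derive_pair[/is_derive_pair[]]] := dc t.
  have [|s] := MVT_segment ler01 (fun s _ => dth s).
    by apply: is_derive1_continuous => s _; exact: dth.
  rewrite in_itv /= subr0 mulr1 => /andP[s0 _] ->.
  have Cl := Cmono s s0.
  have : a0 * (1 / 2) <= flat 0 (1 - r s) * cosz (c s).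
    by apply: ler_pM; [exact: ltW | lra | exact: F0 | lra].
  by lra.
Qed.

(** The denominator serves both conditions: [e <= a0 / 32] covers the change of [cosz], at most
    [8 e] since [2 pi < 8], and [n e <= a0 / 48] covers the change of [radius2], at most [6 n e]. *)
Lemma attractor_margin (u v : coords) :
  1 / 2 + a0 / 4 <= cosz u -> radius2 u <= 1 / 2 - a0 / 8 ->
  `|v - u| < a0 / (48 * n%:R + 32) -> 1 / 2 <= cosz v /\ radius2 v <= 1 / 2.
Proof.
set e := a0 / (48 * n%:R + 32) => Cu Su uv.
have n0 := ler0n R n.
have D0 : 0 < 48 * n%:R + 32 :> R by lra.
have e0 : 0 <= e by rewrite divr_ge0 ?ltW.
have eD : e * (48 * n%:R + 32) = a0 by apply: divfK; rewrite gt_eqF.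
have ne : 0 <= n%:R * e by rewrite mulr_ge0.
have e32 : e <= a0 / 32 by lra.
have en : n%:R * e <= a0 / 48 by lra.
have [_ hx hy hz] := (coords_norm_le (v - u) e0).1 (ltW uv); split.
- have := @derive_bound_lipschitz R _ (real_ode_space R) (@cos R) (fun x => - sin x) 1
    (2 * pi * u.2) (2 * pi * v.2) (fun r => is_derive_cos r).
  move=> /(_ _)/wrap[]; first by move=> tau _; rewrite normrN; exact: sin_max.
  have p0 := pi_gt0 R; have p2 := pihalf_lt2 R.
  rewrite mul1r -/(cosz v) -/(cosz u) -mulrBr normrM ger0_norm ?mulr_ge0 ?(ltW p0)//.
  have h : 2 * pi * `|v.2 - u.2| <= 8 * e.
    by apply: ler_pM => //; [rewrite mulr_ge0// ltW | lra].
  by move=> h2; have := le_trans h2 h; rewrite ler_norml => /andP[]; lra.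
- have [|ux uy] := @radius2_bound R n u 1 ler01; first by rewrite expr1n; lra.
  move: ux uy => /(rV_norm_le _ ler01) ux /(rV_norm_le _ ler01) uy.
  (* Factor [b ^ 2 - a ^ 2] and use [|b + a| <= 3]. Each index contributes two such terms to
     [radius2]. *)
  have sq (a b : R) : `|a| <= 1 -> `|b - a| <= e -> b * b <= a * a + 3 * e.
    move=> a1 be; have e1 : e <= 1 by move: a0_le1; lra.
    have b1 : `|b + a| <= 3.
      rewrite (_ : b + a = (b - a) + a + a); last by ring.
      have := ler_normD (b - a + a) a; have := ler_normD (b - a) a.
      by lra.
    have := le_trans (ler_norm ((b - a) * (b + a))) _ (z := e * 3).
    rewrite normrM => /(_ (ler_pM (normr_ge0 _) (normr_ge0 _) be b1)).
    by rewrite (_ : (b - a) * (b + a) = b * b - a * a); [lra | ring].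
  have : radius2 v <= \sum_(j < n) (u.1.1.2 0 j * u.1.1.2 0 j + u.1.2 0 j * u.1.2 0 j + 6 * e).
    apply: ler_sum => j _.
    have := sq _ _ (ux j); have := sq _ _ (uy j).
    have := hx j; have := hy j; rewrite !mxE => h1 h2 /(_ _ h1) + /(_ _ h2); lra.
  rewrite big_split /= sumr_const card_ord -/(radius2 u) -mulr_natl; lra.
Qed.

End Trapping.

(** * A Hamiltonian map with a trapping region of positive drift *)

Theorem corollary9p1 (R : realType) (n : nat) (hn : (1 <= n)%N) :
  ~ rokhlin_property (Hamc R n).
Proof.
pose X := fun p : mfd R n => attractor_field (mfd_lift p).
have sX : smooth_family (fun _ : R => X) := @attractor_field_smooth R n.
have cX : compactly_supported (fun _ : R => X) := @attractor_field_supp R n.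
have [phi [f [fX fphi]]] := autonomous_flow sX cX.
have Hf : Hamc R n f.
  exists (fun _ => X), (fun _ p => attractor_ham (mfd_lift p)), phi; split=> //.
  - exact: attractor_ham_smooth.
  - exact: attractor_hamiltonian.
have [df hdf dfE] := flow_theta_cocycle sX cX fX fphi.
(* Periodicity makes these conditions independent of the chosen lift. *)
pose A := [set p : mfd R n | 1 / 2 <= cosz (mfd_lift p) /\ radius2 (mfd_lift p) <= 1 / 2].
have a0 : 0 < flat 0 (1 / 2 : R) by apply: flat_gt0; lra.
have step (p : mfd R n) : A p -> exists2 u, mfd_proj u = uhfun f p &
    [/\ 1 / 2 + flat 0 (1 / 2) / 4 <= cosz u,
    radius2 u <= 1 / 2 - flat 0 (1 / 2) / 8 & flat 0 (1 / 2) / 2 <= df p].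
  move=> [C0 S0]; have [c [c0 ic _]] := flow_lift (mfd_lift p) fX.
  have [d1 pc] := dfE c ic; rewrite c0 mfd_liftK in d1 pc.
  have dc (t : R) : is_derive t 1 c (attractor_field (c t)).
    rewrite -(attractor_field_periodic (mfd_liftK (mfd_proj (c t)))); exact: ic.
  have [] := attractor_trap dc; rewrite ?c0// => h1 h2 h3.
  by exists (c 1) => //; split => //; rewrite d1 /= -/(c 1).
(* The base point lies on the attracting circle, the drift is that of [attractor_trap], and the
   tolerance is that of [attractor_margin]. *)
apply: (@attractor_not_rokhlin R n hn f df A (mfd_proj 0)
  (flat 0 (1 / 2) / 2) (flat 0 (1 / 2) / (48 * n%:R + 32)) Hf hdf).
(* The chosen lift of [mfd_proj 0] need not be [0], but it has the same [radius2] and [cosz]. *)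
- have [_ _ er ec _] := periodic_coords (mfd_liftK (mfd_proj (0 : coords R n))).
  rewrite /A /= er ec /cosz mulr0 cos0 /radius2 big1; first by split; lra.
  by move=> j _; rewrite !mxE; ring.
- by lra.
- by rewrite divr_gt0//; have := ler0n R n; lra.
- by move=> p /step[u _ []].
- move=> p q /step[u <- [Cu Su _]] /mfd_dist_lift[v <- uv].
  have [_ _ er ec _] := periodic_coords (mfd_liftK (mfd_proj v)).
  by rewrite /A /= er ec; exact: attractor_margin uv.
Qed.
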